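(* Suppose that $(M,\mathbf m)$ is a metric projective structure of dimension $n\ge2$ with Weyl nullity and $B$ constant ($B=B^g$ for $g\in\mathbf m$). Then the solutions $\sigma^{bc}\in\Gamma(S^2TM(-2))$ of the metrisability equation $$\operatorname{trace-free}(\nabla_a\sigma^{bc})=0$$ are in one-to-one correspondence with solutions of the system $$\nabla^{\mathcal T_1}_a\begin{pmatrix}\sigma^{bc}\\ \mu^b\\ \rho'\end{pmatrix}=0,$$ i.e. with sections of $S^2\mathcal T$ that are parallel for $\nabla^{\mathcal T_1}$ (the solution $\sigma^{bc}$ being the first component of the parallel section).
   Context: Manifolds are smooth and connected; metrics have arbitrary signature; indices are abstract. Two metrics are projectively equivalent if they have the same geodesics up to reparametrisation; a metric projective structure $\mathbf m$ is an equivalence class of projectively equivalent metrics. For the Levi-Civita connection $\nabla$ of $g$: $[\nabla_\ell,\nabla_k]v^j=R^j{}_{i\ell k}v^i$, $R_{jk}=R^a{}_{jak}$, $\mathsf P_{jk}=\frac1{n-1}R_{jk}$, $\mathsf P^i{}_j=g^{ik}\mathsf P_{kj}$. The projective Weyl tensor $W^i{}_{jk\ell}=R^i{}_{jk\ell}+\delta^i_\ell\mathsf P_{jk}-\delta^i_k\mathsf P_{j\ell}$ is the same for all $g\in\mathbf m$. $(M,\mathbf m)$ has Weyl nullity if at every $x$ there is $0\ne v\in T_xM$ with $W^i{}_{jk\ell}v^j=0$. Then each $g\in\mathbf m$ determines a function $B=B^g$ by $\mathsf P^i{}_jv^j=Bv^i$ for all $v$ in the nullity (independent of $v$). $\mathcal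 E(1)$ is the positive $(2n+2)$-nd root of $(\Lambda^nTM)^2$, $\mathcal E(w)$ its real powers, $\mathcal B(w)=\mathcal B\otimes\mathcal E(w)$. The metrisability equation is equivalent to the existence of $\mu^b\in\Gamma(TM(-2))$ with $\nabla_a\sigma^{bc}+\delta^b_a\mu^c+\delta^c_a\mu^b=0$, and does not depend on the choice of $g\in\mathbf m$ used to compute $\nabla$. The tractor bundle $\mathcal T$ is the dual of $J^1\mathcal E(1)$. A choice of $g\in\mathbf m$ splits $\mathcal T\cong TM(-1)\oplus\mathcal E(-1)$, sections being $(\nu^b,\rho)$, and correspondingly $S^2\mathcal T\cong S^2TM(-2)\oplus TM(-2)\oplus\mathcal E(-2)$, the square of $(\nu^b,\rho)$ having components $(\nu^b\nu^c,\rho\nu^b,\rho^2)$. In this splitting the connection $\nabla^{\mathcal T_1}$ on $S^2\mathcal T$ is $$\nabla^{\mathcal T_1}_a\begin{pmatrix}\sigma^{bc}\\ \mu^b\\ \rho\end{pmatrix}=\begin{pmatrix}\nabla_a\sigma^{bc}+\delta^b_a\mu^c+\delta^c_a\mu^b\\ \nabla_a\mu^b+\delta^b_a\rho-Bg_{ac}\sigma^{bc}\\ \nabla_a\rho-2Bg_{ab}\mu^b\end{pmatrix};$$ it is independent of the choice of $g\in\mathbf m$. *)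

(* Defs.v *)
From HB Require Import structures.
From mathcomp Require Import all_boot all_order all_algebra.
From mathcomp Require Import all_classical all_reals all_analysis.

Set Implicit Arguments.
Unset Strict Implicit.
Unset Printing Implicit Defensive.

Import Order.TTheory GRing.Theory Num.Theory.
Import numFieldNormedType.Exports.

Local Open Scope classical_set_scope.
Local Open Scope ring_scope.

(** Differential geometry in charts.  Points of coordinate space are row
    vectors; every geometric object is a family of component functions, one for
    each chart of a fixed atlas, related on overlaps by a transformation law. *)

Section Calculus.
Context {R : realType} {n : nat}.

Definition pd (i : 'I_n) (f : 'rV[R]_n -> R) (y : 'rV[R]_n) : R :=
  'D_(delta_mx 0 i) f y.

Definition iter_pd (s : seq 'I_n) (f : 'rV[R]_n -> R) : 'rV[R]_n -> R :=
  foldr pd f s.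

(** On an open set this is C^infinity: differentiability of all iterated
    partial derivatives entails their continuity. *)
Definition smooth_on (U : set 'rV[R]_n) (f : 'rV[R]_n -> R) : Prop :=
  forall (s : seq 'I_n) (y : 'rV[R]_n), U y -> differentiable (iter_pd s f) y.

Definition smooth_mx_on (p q : nat) (U : set 'rV[R]_n)
    (f : 'rV[R]_n -> 'M[R]_(p, q)) : Prop :=
  forall i j, smooth_on U (fun y => f y i j).

(** [jacobian f y i j] is the derivative of the [i]-th component of [f] in the
    [j]-th direction. *)
Definition jacobian (f : 'rV[R]_n -> 'rV[R]_n) (y : 'rV[R]_n) : 'M[R]_n :=
  \matrix_(i, j) pd j (fun z => f z 0 i) y.

End Calculus.

(** A smooth connected manifold without boundary, presented by an atlas.
    [chart_inv a] is only meaningful on the image of the chart [a]. *)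
Record manifold (R : realType) (n : nat) := Manifold {
  points : topologicalType ;
  chart_ix : Type ;
  chart_dom : chart_ix -> set points ;
  chart_map : chart_ix -> points -> 'rV[R]_n ;
  chart_inv : chart_ix -> 'rV[R]_n -> points ;
  chart_dom_open : forall a, open (chart_dom a) ;
  chart_im_open : forall a, open (chart_map a @` chart_dom a) ;
  chart_mapK :
    forall a x, chart_dom a x -> chart_inv a (chart_map a x) = x ;
  chart_map_continuous :
    forall a x, chart_dom a x -> {for x, continuous (chart_map a)} ;
  chart_inv_continuous :
    forall a y, (chart_map a @` chart_dom a) y ->
      {for y, continuous (chart_inv a)} ;
  chart_cover : forall x, exists a, chart_dom a x ;
  chart_compatible : forall a b,
    smooth_mx_on (chart_map a @` (chart_dom a `&` chart_dom b))
                 (chart_map b \o chart_inv a) ;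
  manifold_hausdorff : hausdorff_space points ;
  manifold_second_countable : @second_countable points ;
  manifold_nonempty : [set: points] !=set0 ;
  manifold_connected : connected [set: points]
}.

Section Fields.
Context {R : realType} {n : nat} (M : manifold R n).

Definition chart_im (a : chart_ix M) : set 'rV[R]_n :=
  chart_map a @` chart_dom a.

Definition overlap (a b : chart_ix M) : set 'rV[R]_n :=
  chart_map a @` (chart_dom a `&` chart_dom b).

Definition transition (a b : chart_ix M) : 'rV[R]_n -> 'rV[R]_n :=
  chart_map b \o chart_inv a.

Definition trans_jac (a b : chart_ix M) : 'rV[R]_n -> 'M[R]_n :=
  jacobian (transition a b).

Definition field (p q : nat) : Type := chart_ix M -> 'rV[R]_n -> 'M[R]_(p, q).

(** Smooth sections of the bundle with transformation law [law]:
    [law a b y u v] says that [u] and [v] are the components in the charts [a]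
    and [b] of the same element of the fibre over the point with
    [a]-coordinates [y].  Components are set to 0 outside the image of the
    chart, so that equality of sections is equality of families. *)
Definition is_section (p q : nat)
    (law : chart_ix M -> chart_ix M -> 'rV[R]_n ->
           'M[R]_(p, q) -> 'M[R]_(p, q) -> Prop)
    (s : field p q) : Prop :=
  [/\ forall a, smooth_mx_on (chart_im a) (s a),
      forall a y, ~ chart_im a y -> s a y = 0
    & forall a b y, overlap a b y ->
        law a b y (s a y) (s b (transition a b y))].

(** Change of the components of a section of E(w) from the chart [a] to the
    chart [b]: sections of the bundle Lambda^n TM are multiplied by the Jacobian
    determinant, and E(1) is the positive (2n+2)-nd root of its square. *)
Definition density_factor (w : R) (a b : chart_ix M) (y : 'rV[R]_n) : R :=
  `|\det (trans_jac a b y)| `^ (w / n.+1%:R).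

(** S^2 TM (w) *)
Definition is_S2TM_section (w : R) (s : field n n) : Prop :=
  is_section (fun a b y u v =>
      v = density_factor w a b y *:
            (trans_jac a b y *m u *m (trans_jac a b y)^T)) s
  /\ forall a y, (s a y)^T = s a y.

Definition is_metric (g : field n n) : Prop :=
  [/\ is_section (fun a b y u v =>
        u = (trans_jac a b y)^T *m v *m trans_jac a b y) g,
      forall a y, (g a y)^T = g a y
    & forall a y, chart_im a y -> g a y \in unitmx].

Section LeviCivita.
Variables (g : field n n) (a : chart_ix M) (y : 'rV[R]_n).

(** [christoffel g a y i j k] is Gamma^i_{jk} *)
Definition christoffel (i j k : 'I_n) : R :=
  2^-1 * \sum_l invmx (g a y) i l *
    (pd j (fun z => g a z l k) y + pd k (fun z => g a z j l) y
     - pd l (fun z => g a z j k) y).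

End LeviCivita.

(** [riemann g a y j i l k] is R^j_{i l k}, the coefficient in
    [nabla_l, nabla_k] v^j = R^j_{i l k} v^i. *)
Definition riemann (g : field n n) (a : chart_ix M) (y : 'rV[R]_n)
    (j i l k : 'I_n) : R :=
  pd l (fun z => christoffel g a z j k i) y
  - pd k (fun z => christoffel g a z j l i) y
  + \sum_m (christoffel g a y j l m * christoffel g a y m k i
            - christoffel g a y j k m * christoffel g a y m l i).

Definition ricci (g : field n n) (a : chart_ix M) (y : 'rV[R]_n)
    (j k : 'I_n) : R := \sum_i riemann g a y i j i k.

Definition schouten (g : field n n) (a : chart_ix M) (y : 'rV[R]_n)
    (j k : 'I_n) : R := ricci g a y j k / (n%:R - 1).

(** [schouten_up g a y i j] is P^i_j *)
Definition schouten_up (g : field n n) (a : chart_ix M) (y : 'rV[R]_n)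
    (i j : 'I_n) : R := \sum_k invmx (g a y) i k * schouten g a y k j.

(** [weyl g a y i j k l] is W^i_{j k l} *)
Definition weyl (g : field n n) (a : chart_ix M) (y : 'rV[R]_n)
    (i j k l : 'I_n) : R :=
  riemann g a y i j k l + (i == l)%:R * schouten g a y j k
  - (i == k)%:R * schouten g a y j l.

(** The tangent vector with components [v] in the chart [a] at the point with
    coordinates [y] lies in the nullity of the projective Weyl tensor. *)
Definition in_nullity (g : field n n) (a : chart_ix M) (y : 'rV[R]_n)
    (v : 'cV[R]_n) : Prop :=
  forall i k l, \sum_j weyl g a y i j k l * v j 0 = 0.

(** [B] is the function B^g defined by P^i_j v^j = B v^i on the nullity. *)
Definition is_nullity_function (g : field n n) (B : points M -> R) : Prop :=
  forall a x, chart_dom a x ->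
  forall v : 'cV[R]_n, in_nullity g a (chart_map a x) v ->
  forall i, \sum_j schouten_up g a (chart_map a x) i j * v j 0 = B x * v i 0.

(** ** Projective equivalence *)

Definition open_interval (I : set R) : Prop :=
  [/\ open I, is_interval I & I !=set0].

Definition curve_coord (a : chart_ix M) (c : R -> points M) (i : 'I_n)
    (t : R) : R := chart_map a (c t) 0 i.

Definition smooth_curve (I : set R) (c : R -> points M) : Prop :=
  forall t, I t -> {for t, continuous c} /\
    forall a, chart_dom a (c t) ->
    forall i k, derivable (derive1n k (curve_coord a c i)) t 1.

(** affinely parametrised geodesics *)
Definition geodesic (g : field n n) (I : set R) (c : R -> points M) : Prop :=
  smooth_curve I c /\
  forall t, I t -> forall a, chart_dom a (c t) ->
  forall i, derive1n 2 (curve_coord a c i) t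
    + \sum_j \sum_k christoffel g a (chart_map a (c t)) i j k
        * derive1 (curve_coord a c j) t * derive1 (curve_coord a c k) t = 0.

Definition reparametrisation (J I : set R) (phi : R -> R) : Prop :=
  [/\ phi @` J = I,
      forall t, J t -> forall k, derivable (derive1n k phi) t 1
    & forall t, J t -> derive1 phi t != 0].

Definition geodesics_reparametrise (g h : field n n) : Prop :=
  forall I c, open_interval I -> geodesic g I c ->
  exists J phi, [/\ open_interval J, reparametrisation J I phi
                  & geodesic h J (c \o phi)].

Definition proj_equivalent (g h : field n n) : Prop :=
  geodesics_reparametrise g h /\ geodesics_reparametrise h g.

Definition metric_projective_structure (m : set (field n n)) : Prop :=
  exists2 g, is_metric g & m = [set h | is_metric h /\ proj_equivalent g h].

(** The Weyl tensor is the same for all the metrics of [m]. *)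
Definition has_weyl_nullity (m : set (field n n)) : Prop :=
  forall g, m g -> forall a x, chart_dom a x ->
  exists2 v : 'cV[R]_n, v != 0 & in_nullity g a (chart_map a x) v.

(** ** The metrisability equation *)

Section Derivatives.
Variables (g : field n n) (a : chart_ix M) (w : R).

(** Gamma^d_{k d} / (n + 1): the Levi-Civita connection on E(w) is
    d_k + w Gamma^d_{k d} / (n + 1). *)
Definition density_form (y : 'rV[R]_n) (k : 'I_n) : R :=
  (\sum_d christoffel g a y d k d) / n.+1%:R.

Definition nabla_density (f : 'rV[R]_n -> R) (y : 'rV[R]_n) (k : 'I_n) : R :=
  pd k f y + w * density_form y k * f y.

(** [nabla_TM mu y k b] is nabla_k mu^b, for mu of weight [w] *)
Definition nabla_TM (mu : 'rV[R]_n -> 'cV[R]_n) (y : 'rV[R]_n)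
    (k b : 'I_n) : R :=
  nabla_density (fun z => mu z b 0) y k
  + \sum_d christoffel g a y b k d * mu y d 0.

(** [nabla_S2TM s y k b c] is nabla_k s^{b c}, for s of weight [w] *)
Definition nabla_S2TM (s : 'rV[R]_n -> 'M[R]_n) (y : 'rV[R]_n)
    (k b c : 'I_n) : R :=
  nabla_density (fun z => s z b c) y k
  + \sum_d (christoffel g a y b k d * s y d c
            + christoffel g a y c k d * s y b d).

End Derivatives.

(** Trace-free part of T_k^{b c}, for T symmetric in its upper indices *)
Definition trace_free (T : 'I_n -> 'I_n -> 'I_n -> R) (k b c : 'I_n) : R :=
  T k b c - (n.+1%:R)^-1 * ((k == b)%:R * (\sum_d T d d c)
                            + (k == c)%:R * (\sum_d T d d b)).

Definition metrisability_solution (g : field n n) (s : field n n) : Prop :=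
  is_S2TM_section (-2) s /\
  forall a y, chart_im a y ->
  forall k b c, trace_free (nabla_S2TM g a (-2) (s a) y) k b c = 0.

(** ** Tractors *)

(** The 1-jet of a section f of E(1) has components (d_k f, f), as a column
    with the derivatives first; this is its change from the chart [a] to the
    chart [b], obtained by differentiating the law of change of f. *)
Definition jet_cocycle (a b : chart_ix M) (y : 'rV[R]_n) : 'M[R]_(n + 1) :=
  let lambda := density_factor 1 a b in
  let Jinv := (invmx (trans_jac a b y))^T in
  block_mx (lambda y *: Jinv) (Jinv *m \col_k pd k lambda y)
           0                  (lambda y)%:M.

(** S^2 T, where T is the dual of J^1 E(1): the components X of an element
    of T satisfy X_a = K^T X_b, with K the cocycle of J^1 E(1). *)
Definition is_S2T_section (S : field (n + 1) (n + 1)) : Prop :=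
  is_section (fun a b y u v =>
      u = (jet_cocycle a b y)^T *m v *m jet_cocycle a b y) S
  /\ forall a y, (S a y)^T = S a y.

(** (d_k f, f) |-> (nabla_k f, f), the splitting of J^1 E(1) given by [g] *)
Definition jet_splitting (g : field n n) (a : chart_ix M) (y : 'rV[R]_n) :
    'M[R]_(n + 1) :=
  block_mx 1%:M (\col_k density_form g a y k)
           0    1%:M.

(** The components [sigma, mu; mu^T, rho] of [S] in the splitting given by [g],
    dual to [jet_splitting]. *)
Definition tractor_split (g : field n n) (S : field (n + 1) (n + 1)) :
    field (n + 1) (n + 1) :=
  fun a y => (invmx (jet_splitting g a y))^T *m S a y
             *m invmx (jet_splitting g a y).

Definition split_sigma (g : field n n) (S : field (n + 1) (n + 1)) :
    field n n := fun a y => ulsubmx (tractor_split g S a y).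

Definition split_mu (g : field n n) (S : field (n + 1) (n + 1)) :
    field n 1 := fun a y => ursubmx (tractor_split g S a y).

Definition split_rho (g : field n n) (S : field (n + 1) (n + 1))
    (a : chart_ix M) (y : 'rV[R]_n) : R := drsubmx (tractor_split g S a y) 0 0.

(** The sections of S^2 T that are parallel for the connection
    nabla^{T_1}, computed with the metric [g] *)
Definition tractor_parallel (g : field n n) (B : points M -> R)
    (S : field (n + 1) (n + 1)) : Prop :=
  is_S2T_section S /\
  forall a y, chart_im a y ->
  let sigma := split_sigma g S a in
  let mu := split_mu g S a in
  let rho := split_rho g S a in
  let By := B (chart_inv a y) in
  [/\ forall k b c, nabla_S2TM g a (-2) sigma y k b c
        + (k == b)%:R * mu y c 0 + (k == c)%:R * mu y b 0 = 0,
      forall k b, nabla_TM g a (-2) mu y k b + (k == b)%:R * rho y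
        - By * (\sum_c g a y k c * sigma y b c) = 0
    & forall k, nabla_density g a (-2) rho y k
        - 2 * By * (\sum_b g a y k b * mu y b 0) = 0].

End Fields.

(* Main.v *)
(** For a metric g of the class, nullity of the projective Weyl tensor at v says
    that the algebraic curvature tensor Z = R - B (g g - g g) is annihilated by
    v: symmetry of the Schouten tensor gives P v = B g v, and the pair symmetry
    of R then moves v into any slot.

    The trace-free equation means nabla_k sigma = - (e_k mu + mu e_k) with mu
    the normalised divergence of sigma.  Antisymmetrising a second derivative
    gives, for N_k = nabla_k mu - B sigma g e_k,
      Z_lk sigma + sigma Z_lk^T = e_l N_k + N_k e_l - (k <-> l),
    and contracting with v^k leaves e_l N(v) + N(v) e_l = v N_l + N_l v, which
    forces N_l = - rho e_l for a scalar rho: this is the second tractor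
    equation.  Since B is constant, the same argument applied to mu gives
    Z_lk mu = t_k e_l - t_l e_k with t = nabla rho - 2 B g mu, whose contraction
    with v is t(v) e_l = t_l v; taking the trace, t = 0.  Conversely mu and rho
    are traces of derivatives of sigma and mu, hence determined by sigma; as
    contracted covariant derivatives they also change tensorially between
    charts, so they define a section of S^2 T. *)

Require Import Defs.
From mathcomp Require Import all_boot all_order all_algebra.
From mathcomp Require Import all_classical all_reals all_analysis.
From mathcomp Require Import ring lra.
Import Order.TTheory GRing.Theory Num.Theory.
Import numFieldNormedType.Exports.
Local Open Scope classical_set_scope.
Local Open Scope ring_scope.

Set Implicit Arguments.
Unset Strict Implicit.
Unset Printing Implicit Defensive.

(** * Partial derivatives and smooth functions *)

(** Algebra is kept apart from analysis: derivatives of the metric enter the curvature lemmas as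
    arbitrary matrices subject to the relations that differentiation gives. Besides antisymmetry in
    l, k, the only symmetry of R that is used is pair symmetry, read off the second derivatives of
    g. It also makes R_lk trace-free, so the connection on every E(w) is flat and weights contribute
    no curvature to the Ricci identities. The contraction with v yields rho at each point only as
    some unspecified number. Taking mu and rho to be the explicit traces [div_mu] and [div_rho]
    makes their smoothness and their change of chart accessible before any equation is solved.
    Covariance then reduces to the transformation law of the Christoffel symbols, which is obtained
    from uniqueness of the torsion-free metric connection rather than by direct computation. *)

Lemma near_eq_differentiable (K : numFieldType) (V W : normedModType K)
    (f g : V -> W) (y : V) :
  (\near y, f y = g y) -> differentiable f y -> differentiable g y.
Proof.
move=> fg df.
(* The little-o expansion of [f] at [y] is also one of [g]; [diff_unique] then identifies its linear
   part with the differential of [g]. *)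
have e : g \o shift y = cst (g y) + 'd f y +o_ 0 id.
  apply/eqaddoP => _ /posnumP[e].
  have [_ /eqaddoP/(_ e%:num (ltac:(by []))) fe] := (diff_locallyP _ _).1 df.
  have fg0 : \forall z \near (0 : V), f (z + y) = g (z + y).
    by move: fg; rewrite (near_shift 0); apply: filterS => z /=; rewrite subr0.
  rewrite -(nbhs_singleton fg).
  apply: filterS2 fg0 fe => z /= fgz le_f; apply: le_trans le_f.
  rewrite le_eqVlt; apply/orP; left; apply/eqP; congr (`|_|).
  exact: (congr1 (fun u => u - _) (esym fgz)).
have dc : continuous ('d f y) by exact: diff_continuous.
by apply/diff_locallyP; rewrite (diff_unique dc e).
Qed.

Section PartialDerivatives.
Context {R : realType} {n : nat}.
Implicit Types (f g : 'rV[R]_n -> R) (y : 'rV[R]_n) (i : 'I_n) (U : set 'rV[R]_n).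

Lemma eq_on_near (T : Type) U (f g : 'rV[R]_n -> T) y :
  open U -> U y -> {in U, f =1 g} -> \near y, f y = g y.
Proof.
move=> oU Uy fg; have : \near y, U y by exact: open_nbhs_nbhs.
by apply: filterS => z Uz; apply: fg; rewrite inE.
Qed.

Lemma eq_on_pd U f g y i :
  open U -> U y -> {in U, f =1 g} -> pd i f y = pd i g y.
Proof. by move=> oU Uy fg; apply: near_eq_derive; exact: eq_on_near Uy fg. Qed.

Lemma eq_on_differentiable U f g y :
  open U -> U y -> {in U, f =1 g} -> differentiable f y -> differentiable g y.
Proof.
by move=> oU Uy fg; apply: near_eq_differentiable; exact: eq_on_near Uy fg.
Qed.

Lemma pd_cst i (c : R) y : pd i (fun=> c) y = 0.
Proof. exact: derive_cst. Qed.

Lemma pdD i f g y : differentiable f y -> differentiable g y ->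
  pd i (fun z => f z + g z) y = pd i f y + pd i g y.
Proof. by move=> /diff_derivable df /diff_derivable dg; exact: deriveD. Qed.

Lemma pdB i f g y : differentiable f y -> differentiable g y ->
  pd i (fun z => f z - g z) y = pd i f y - pd i g y.
Proof. by move=> /diff_derivable df /diff_derivable dg; exact: deriveB. Qed.

Lemma pdM i f g y : differentiable f y -> differentiable g y ->
  pd i (fun z => f z * g z) y = pd i f y * g y + f y * pd i g y.
Proof.
move=> /diff_derivable df /diff_derivable dg; rewrite /pd [LHS]deriveM//.
by rewrite addrC [_ *: _]mulrC.
Qed.

Lemma differentiable_bigsum (I : Type) (r : seq I) (P : pred I)
    (F : I -> 'rV[R]_n -> R) y :
  (forall k, differentiable (F k) y) ->
  differentiable (fun z => \sum_(k <- r | P k) F k z) y.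
Proof.
move=> dF; rewrite -fct_sumE.
by elim/big_ind : _ => // ? ? g h; apply: differentiableD; [exact: g|exact: h].
Qed.

Lemma pd_sum (I : Type) (r : seq I) (P : pred I) i (F : I -> 'rV[R]_n -> R) y :
  (forall k, differentiable (F k) y) ->
  pd i (fun z => \sum_(k <- r | P k) F k z) y = \sum_(k <- r | P k) pd i (F k) y.
Proof.
move=> dF; elim: r => [|k r IH].
  by under [in LHS]eq_fun do rewrite big_nil; rewrite big_nil pd_cst.
under [in LHS]eq_fun do rewrite big_cons; rewrite big_cons.
case: (P k); rewrite // pdD ?IH//; exact: differentiable_bigsum.
Qed.

Lemma pdV i f y : differentiable f y -> f y != 0 ->
  pd i (fun z => (f z)^-1) y = - (f y)^-1 * (f y)^-1 * pd i f y.
Proof.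
move=> /diff_derivable df f0; rewrite /pd [LHS]deriveV//.
by rewrite -exprVn expr2 mulNr.
Qed.

Lemma differentiable_prod (I : Type) (r : seq I)
    (F : I -> 'rV[R]_n -> R) y :
  (forall k, differentiable (F k) y) ->
  differentiable (fun z => \prod_(k <- r) F k z) y.
Proof.
move=> dF; elim: r => [|k r IH].
  under eq_fun do rewrite big_nil; exact: differentiable_cst.
by under eq_fun do rewrite big_cons; apply: differentiableM.
Qed.

Lemma pd_prod (I : eqType) (r : seq I) i (F : I -> 'rV[R]_n -> R) y :
  uniq r -> (forall k, differentiable (F k) y) ->
  pd i (fun z => \prod_(k <- r) F k z) y =
  \sum_(k <- r) pd i (F k) y * \prod_(j <- r | j != k) F j y.
Proof.
move=> + dF; elim: r => [_|k r IH /= /andP[kr ur]].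
  by under [in LHS]eq_fun do rewrite big_nil; rewrite big_nil pd_cst.
under [in LHS]eq_fun do rewrite big_cons.
rewrite big_cons pdM//; last exact: differentiable_prod.
rewrite IH// big_cons eqxx/=; congr (_ * _ + _).
  rewrite big_seq [RHS]big_seq_cond; apply: eq_bigl => j.
  by case jr : (j \in r) => //=; apply/esym; apply: contraNneq kr => <-.
rewrite mulr_sumr; apply: eq_big_seq => j jr.
by rewrite big_cons ifT 1?mulrCA//; apply: contraNneq kr => ->.
Qed.

Lemma row_differentiable (p : nat) (h : 'rV[R]_p -> 'rV[R]_n) (y : 'rV[R]_p) :
  (forall j, differentiable (fun z => h z 0 j) y) -> differentiable h y.
Proof.
move=> dh.
have -> : h = \sum_(j < n) (fun z => h z 0 j *: delta_mx 0 j).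
  by apply/funext => z; rewrite fct_sumE [LHS]row_sum_delta.
apply: differentiable_sum => j; exact: differentiableZl.
Qed.

Lemma diff_row (p : nat) (h : 'rV[R]_p -> 'rV[R]_n) (y : 'rV[R]_p) v j :
  differentiable h y -> ('d h y v) 0 j = 'd (fun z => h z 0 j : R) y v.
Proof.
move=> dh; have dj := differentiable_coord (h y) 0 j.
rewrite -!deriveE//; last first.
  exact: (differentiable_comp dh dj).
by rewrite derive_mx ?mxE//; exact: diff_derivable.
Qed.

Lemma pd_comp (p : nat) (h : 'rV[R]_p -> 'rV[R]_n) f (y : 'rV[R]_p) (i : 'I_p) :
  (forall j, differentiable (fun z => h z 0 j) y) -> differentiable f (h y) ->
  pd i (f \o h) y = \sum_j pd j f (h y) * pd i (fun z => h z 0 j) y.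
Proof.
move=> dhj df; have dh := row_differentiable dhj.
rewrite /pd deriveE; last exact: differentiable_comp.
rewrite diff_comp//= [X in 'd f (h y) X]row_sum_delta linear_sum.
apply: eq_bigr => j _; rewrite linearZ deriveE// deriveE// diff_row//.
exact: mulrC.
Qed.

Lemma differentiable_comp_row (p : nat) (h : 'rV[R]_p -> 'rV[R]_n) f (y : 'rV[R]_p) :
  (forall j, differentiable (fun z => h z 0 j) y) -> differentiable f (h y) ->
  differentiable (f \o h) y.
Proof.
by move=> dhj df; apply: differentiable_comp => //; exact: row_differentiable.
Qed.

End PartialDerivatives.

Section Smooth.
Context {R : realType} {n : nat}.
Implicit Types (f g : 'rV[R]_n -> R) (y : 'rV[R]_n) (i : 'I_n) (U : set 'rV[R]_n).

(* [C^k] functions, graded so that closure properties can be proved by induction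
   on the order of differentiation. *)
Fixpoint Ck_on (k : nat) U f : Prop :=
  (forall y, U y -> differentiable f y) /\
  if k is k'.+1 then forall i, Ck_on k' U (pd i f) else True.

Lemma Ck_on_differentiable k U f y : Ck_on k U f -> U y -> differentiable f y.
Proof. by case: k => [|k] /= [df _]; exact: df. Qed.

Lemma Ck_onS k U f : Ck_on k.+1 U f -> Ck_on k U f.
Proof.
elim: k f => [|k IH] f /= [df cf]; split=> // i; apply: IH; exact: cf.
Qed.

Lemma smooth_onP U f : smooth_on U f <-> forall k, Ck_on k U f.
Proof.
split=> [+ k|cf s].
  elim: k f => [|k IH] f sf /=; split=> //; try exact: (sf [::]).
  move=> i; apply: IH => s y Uy.
  by have := sf (rcons s i) y Uy; rewrite /iter_pd foldr_rcons.
have {cf} := cf (size s).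
(* The innermost derivative in [iter_pd s f] is the last entry of [s], so [s] is peeled from the
   right. *)
elim/last_ind: s f => [|s i IH] f /=; first by case.
rewrite size_rcons /= => -[_ /(_ i)/IH]; by rewrite /iter_pd foldr_rcons.
Qed.

Lemma eq_on_Ck k U f g : open U -> {in U, f =1 g} -> Ck_on k U f -> Ck_on k U g.
Proof.
move=> oU; elim: k f g => [|k IH] f g fg /= [df cf]; split=> //.
- by move=> y Uy; apply: eq_on_differentiable fg (df _ Uy).
- by move=> y Uy; apply: eq_on_differentiable fg (df _ Uy).
- move=> i; apply: IH (cf i) => y; rewrite inE => Uy; exact: eq_on_pd fg.
Qed.

Lemma Ck_on_cst k U (c : R) : open U -> Ck_on k U (fun=> c).
Proof.
move=> oU; elim: k c => [|k IH] c /=; split=> //.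
by move=> i; apply: eq_on_Ck oU _ (IH 0) => y _; rewrite pd_cst.
Qed.

Lemma Ck_onD k U f g : open U -> Ck_on k U f -> Ck_on k U g -> Ck_on k U (fun z => f z + g z).
Proof.
move=> oU; elim: k f g => [|k IH] f g /= [df cf] [dg cg]; split=> //.
- move=> y Uy; exact: differentiableD (df _ Uy) (dg _ Uy).
- move=> y Uy; exact: differentiableD (df _ Uy) (dg _ Uy).
- move=> i; apply: eq_on_Ck oU _ (IH _ _ (cf i) (cg i)) => y; rewrite inE => Uy.
  by rewrite pdD//; [exact: df|exact: dg].
Qed.

Lemma Ck_onM k U f g : open U -> Ck_on k U f -> Ck_on k U g -> Ck_on k U (fun z => f z * g z).
Proof.
move=> oU; elim: k f g => [|k IH] f g.
  move=> [df _] [dg _]; split=> // y Uy; exact: differentiableM (df _ Uy) (dg _ Uy).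
move=> cf cg; split=> [y Uy|i].
  exact: differentiableM (Ck_on_differentiable cf Uy) (Ck_on_differentiable cg Uy).
apply: (@eq_on_Ck _ _ (fun z => pd i f z * g z + f z * pd i g z)) => //.
  move=> y; rewrite inE => Uy; rewrite pdM//.
  - exact: Ck_on_differentiable cf Uy.
  - exact: Ck_on_differentiable cg Uy.
by apply: Ck_onD => //; apply: IH;
  [exact: cf.2|exact: Ck_onS|exact: Ck_onS|exact: cg.2].
Qed.

Lemma Ck_onV k U f : open U -> (forall y, U y -> f y != 0) ->
  Ck_on k U f -> Ck_on k U (fun z => (f z)^-1).
Proof.
move=> oU f0; elim: k => [|k IH] cf; have dV y (Uy : U y) :=
  differentiableV (Ck_on_differentiable cf Uy) (f0 _ Uy); split=> // i.
apply: (@eq_on_Ck _ _ (fun z => (- 1 * ((f z)^-1 * (f z)^-1)) * pd i f z)) => //.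
  move=> y; rewrite inE => Uy; rewrite pdV ?mulN1r ?mulNr//; last exact: f0.
  exact: Ck_on_differentiable cf Uy.
have cV := IH (Ck_onS cf).
apply: Ck_onM => //; last exact: cf.2.
by apply: Ck_onM => //; [exact: Ck_on_cst|exact: Ck_onM].
Qed.

Lemma smooth_differentiable U f y : smooth_on U f -> U y -> differentiable f y.
Proof. by move=> /(_ [::]); apply. Qed.

Lemma smooth_pd U f i : smooth_on U f -> smooth_on U (pd i f).
Proof.
by move=> sf s y Uy; have := sf (rcons s i) y Uy; rewrite /iter_pd foldr_rcons.
Qed.

Lemma eq_on_smooth U f g :
  open U -> {in U, f =1 g} -> smooth_on U f -> smooth_on U g.
Proof. by move=> oU fg /smooth_onP cf; apply/smooth_onP => k; exact: eq_on_Ck fg (cf k). Qed.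

Lemma smooth_cst U (c : R) : open U -> smooth_on U (fun=> c).
Proof. by move=> oU; apply/smooth_onP => k; exact: Ck_on_cst. Qed.

Lemma smoothD U f g : open U -> smooth_on U f -> smooth_on U g ->
  smooth_on U (fun z => f z + g z).
Proof. by move=> oU /smooth_onP cf /smooth_onP cg; apply/smooth_onP => k; exact: Ck_onD. Qed.

Lemma smoothM U f g : open U -> smooth_on U f -> smooth_on U g ->
  smooth_on U (fun z => f z * g z).
Proof. by move=> oU /smooth_onP cf /smooth_onP cg; apply/smooth_onP => k; exact: Ck_onM. Qed.

Lemma smoothV U f : open U -> (forall y, U y -> f y != 0) ->
  smooth_on U f -> smooth_on U (fun z => (f z)^-1).
Proof. by move=> oU f0 /smooth_onP cf; apply/smooth_onP => k; exact: Ck_onV. Qed.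

Lemma smoothN U f : open U -> smooth_on U f -> smooth_on U (fun z => - f z).
Proof.
move=> oU sf; apply: (@eq_on_smooth _ (fun z => -1 * f z)) => // [y _|].
  by rewrite mulN1r.
by apply: smoothM => //; exact: smooth_cst.
Qed.

Lemma smooth_sum (I : Type) (r : seq I) (P : pred I) U
    (F : I -> 'rV[R]_n -> R) : open U ->
  (forall k, smooth_on U (F k)) -> smooth_on U (fun z => \sum_(k <- r | P k) F k z).
Proof.
move=> oU sF; rewrite -fct_sumE.
elim/big_ind : _ => //; first exact: smooth_cst.
by move=> ? ?; exact: smoothD.
Qed.

Lemma smooth_prod (I : Type) (r : seq I) (P : pred I) U
    (F : I -> 'rV[R]_n -> R) : open U ->
  (forall k, smooth_on U (F k)) -> smooth_on U (fun z => \prod_(k <- r | P k) F k z).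
Proof.
move=> oU sF; elim: r => [|k r IH].
  by apply: (eq_on_smooth oU _ (smooth_cst 1 oU)) => y _; rewrite big_nil.
case Pk : (P k).
  by apply: (eq_on_smooth oU _ (smoothM oU (sF k) IH)) => y _; rewrite big_cons Pk.
by apply: (eq_on_smooth oU _ IH) => y _; rewrite big_cons Pk.
Qed.

End Smooth.

(** * Symmetry of second derivatives *)

Section Schwarz.
Context {R : realType} {n : nat}.
Implicit Types (f : 'rV[R]_n -> R) (y v : 'rV[R]_n) (U : set 'rV[R]_n).

Lemma derive_line f y v (t : R) : differentiable f (y + t *: v) ->
  is_derive t 1 (fun s : R => f (y + s *: v)) ('D_v f (y + t *: v)).
Proof.
move=> df.
have e : (fun h : R => h^-1 *: (f (y + (h *: (1 : R) + t) *: v) - f (y + t *: v))) =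
         (fun h => h^-1 *: (f (h *: v + (y + t *: v)) - f (y + t *: v))).
  by apply/funext => h; rewrite -[h *: (1 : R)]/(h * 1) mulr1 scalerDl addrCA.
split; first by rewrite /derivable/= e; exact: diff_derivable.
by rewrite /derive/= e.
Qed.

Lemma MVT_line f y v (h : R) : 0 < h ->
  (forall t, 0 <= t <= h -> differentiable f (y + t *: v)) ->
  exists2 t, 0 <= t <= h & f (y + h *: v) - f y = h * 'D_v f (y + t *: v).
Proof.
move=> h0 df.
have [|||t] := @MVT R (fun s => f (y + s *: v)) (fun s => 'D_v f (y + s *: v)) 0 h.
- by [].
- by move=> t; rewrite in_itv/= => /andP[t0 th]; apply: derive_line; apply: df; rewrite !ltW.
- apply: continuous_in_subspaceT => t; rewrite inE/= in_itv/= => th.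
  apply: differentiable_continuous.
  by have [/derivable1_diffP] := derive_line (df t th).
rewrite in_itv/= => /andP[t0 th]; rewrite scale0r addr0 subr0 mulrC => ->.
by exists t => //; rewrite !ltW.
Qed.

(** The mean value theorem is applied twice: to x |-> f(x + h e_j) - f(x) in direction i, then to
    [pd i f] in direction j. In the sup norm the radius 2 h leaves room for i = j, where the two
    steps add up. *)
Lemma second_difference f y (i j : 'I_n) (h : R) : 0 < h ->
  (forall z, `|z - y| <= h *+ 2 -> differentiable f z /\ differentiable (pd i f) z) ->
  exists2 z, `|z - y| <= h *+ 2 &
    (f (y + h *: delta_mx 0 i + h *: delta_mx 0 j) - f (y + h *: delta_mx 0 i))
    - (f (y + h *: delta_mx 0 j) - f y) = h * (h * pd j (pd i f) z).
Proof.
move=> h0 df.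
set u := delta_mx 0 i; set v := delta_mx 0 j.
have nd (k : 'I_n) (t : R) : 0 <= t <= h -> `|t *: (delta_mx 0 k : 'rV[R]_n)| <= h.
  move=> /andP[t0 th]; rewrite normrZ ger0_norm// -[leRHS]mulr1 ler_pM//.
  rewrite [leLHS]/Num.Def.normr/= mx_normrE; apply: bigmax_le => //= -[a b] _ /=.
  by rewrite mxE/= normr_nat lern1 leq_b1.
pose F z := f (z + h *: v) - f z.
have near2 (s t : R) : 0 <= s <= h -> 0 <= t <= h ->
    `|y + s *: u + t *: v - y| <= h *+ 2.
  move=> sh th; rewrite mulr2n -(addrA y) addrAC subrr add0r.
  by rewrite (le_trans (ler_normD _ _))// lerD// nd.
have near1 (s : R) : 0 <= s <= h -> `|y + s *: u - y| <= h *+ 2.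
  move=> sh; rewrite -[y + s *: u]addr0 -(scale0r v); apply: near2 => //.
  by rewrite lexx ltW.
have hh : 0 <= h <= h by rewrite lexx ltW.
have dsh z (g : 'rV[R]_n -> R) : differentiable g (z + h *: v) ->
    differentiable (fun x => g (x + h *: v)) z.
  move=> dg; apply: (@differentiable_comp _ _ _ _ (fun x => x + h *: v)) => //.
have [t th /= e1] := @MVT_line F y u h h0 (fun t th =>
   differentiableB (dsh _ _ (df _ (near2 t h th hh)).1) (df _ (near1 t th)).1).
have [s sh /= e2] := @MVT_line (pd i f) (y + t *: u) v h h0 (fun s sh =>
   (df _ (near2 t s th sh)).2).
exists (y + t *: u + s *: v); first exact: near2.
rewrite -[pd j _ _]/('D_v _ _) -e2.
rewrite -[LHS]/(F (y + h *: u) - F y) [LHS]e1; congr (_ * _).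
have dF1 := dsh _ _ (df _ (near2 t h th hh)).1.
have -> : pd i f (y + t *: u + h *: v) =
          'D_u (fun x => f (x + h *: v)) (y + t *: u).
  rewrite /pd /derive; apply: (congr1 (fun G : R -> R => lim (G @ 0^'))).
  by apply/funext => k /=; rewrite -(addrA (k *: u)).
by rewrite -(deriveB (diff_derivable dF1) (diff_derivable (df _ (near1 t th)).1)).
Qed.

Let diff2C (a b c d : R) : (a - b) - (c - d) = (a - c) - (b - d).
Proof. by rewrite !opprB addrACA [RHS]addrACA [- c + _]addrC. Qed.

Let dist_half (a b c e : R) : `|a - c| <= e / 2 -> `|b - c| <= e / 2 -> `|a - b| <= e.
Proof.
move=> ac bc; rewrite (le_trans (ler_distD c _ _))// (distrC c).
by rewrite [leRHS]splitr lerD.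
Qed.

(* Equality at [y] follows by continuity, as both sides take a common value
   arbitrarily close to [y]. *)
Lemma pdC U f y (i j : 'I_n) : open U -> smooth_on U f -> U y ->
  pd i (pd j f) y = pd j (pd i f) y.
Proof.
move=> oU sf Uy.
have cont (a b : 'I_n) : {for y, continuous (pd a (pd b f))}.
  apply: differentiable_continuous.
  by apply: smooth_differentiable Uy; do 2 apply: smooth_pd.
apply/eqP; rewrite -subr_eq0 -normr_le0; apply/ler_addgt0Pr => e e0.
have e2 : 0 < e / 2 by rewrite divr_gt0.
have Un : nbhs y U by exact: open_nbhs_nbhs.
have /cvgrPdist_le/(_ _ e2) cij := cont i j.
have /cvgrPdist_le/(_ _ e2) cji := cont j i.
have nb : nbhs y (U `&` ([set t | `|pd i (pd j f) y - pd i (pd j f) t| <= e / 2] `&`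
    [set t | `|pd j (pd i f) y - pd j (pd i f) t| <= e / 2])).
  apply: (@filterI _ (nbhs y)); first exact: Un.
  by apply: (@filterI _ (nbhs y)); [exact: cij|exact: cji].
have [d /= d0 hd] := (nbhs_ballP _ _).1 nb.
have [h0 h2] : 0 < d / 4 /\ d / 4 *+ 2 < d.
  by split; [rewrite divr_gt0|rewrite -mulr_natr; lra].
have hz z : `|z - y| <= d / 4 *+ 2 -> ball y d z.
  by move=> zy; rewrite -ball_normE/= distrC (le_lt_trans zy).
have df a z : `|z - y| <= d / 4 *+ 2 ->
    differentiable f z /\ differentiable (pd a f) z.
  move=> /hz/hd[Uz _]; split; first exact: smooth_differentiable sf Uz.
  by apply: smooth_differentiable Uz; exact: smooth_pd.
have [z zy ez] := @second_difference f y i j _ h0 (df i).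
have [z' zy' ez'] := @second_difference f y j i _ h0 (df j).
have eqz : pd j (pd i f) z = pd i (pd j f) z'.
  have hne : d / 4 != 0 by rewrite gt_eqF.
  have e4 : d / 4 * (d / 4 * pd j (pd i f) z) = d / 4 * (d / 4 * pd i (pd j f) z').
    apply: etrans (esym ez) (etrans _ ez'); rewrite (addrAC y (_ *: delta_mx 0 j)).
    exact: diff2C.
  exact: (mulfI hne (mulfI hne e4)).
have [_ [_ /= +]] := hd _ (hz _ zy).
have [_ [/= + _]] := hd _ (hz _ zy').
rewrite eqz add0r => a b.
exact: dist_half a b.
Qed.

End Schwarz.

(** * Derivatives of matrix-valued functions *)

Fact pdmx_key : unit. Proof. exact: tt. Qed.

Section MatrixCalculus.
Context {R : realType} {n : nat}.
Implicit Types (y : 'rV[R]_n) (k : 'I_n) (U : set 'rV[R]_n).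

(* Locked, lest unification compare two derivatives by unfolding limits. *)
Definition pdmx (p q : nat) k (F : 'rV[R]_n -> 'M[R]_(p, q)) y : 'M[R]_(p, q) :=
  locked_with pdmx_key (\matrix_(i, j) pd k (fun z => F z i j) y).

Lemma pdmxE (p q : nat) k (F : 'rV[R]_n -> 'M[R]_(p, q)) y i j :
  pdmx k F y i j = pd k (fun z => F z i j) y.
Proof. by rewrite /pdmx unlock mxE. Qed.

Definition mx_differentiable (p q : nat) (F : 'rV[R]_n -> 'M[R]_(p, q)) y :=
  forall i j, differentiable (fun z => F z i j) y.

Lemma mx_differentiable_mul (p q r : nat) (F : 'rV[R]_n -> 'M[R]_(p, q))
    (G : 'rV[R]_n -> 'M[R]_(q, r)) y :
  mx_differentiable F y -> mx_differentiable G y ->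
  mx_differentiable (fun z => F z *m G z) y.
Proof.
move=> dF dG i j; under eq_fun do rewrite mxE.
by apply: differentiable_bigsum => l; apply: differentiableM.
Qed.

Lemma mx_differentiable_tr (p q : nat) (F : 'rV[R]_n -> 'M[R]_(p, q)) y :
  mx_differentiable F y -> mx_differentiable (fun z => (F z)^T) y.
Proof. by move=> dF i j; under eq_fun do rewrite mxE; exact: dF. Qed.

Lemma mx_differentiable_scale (p q : nat) (c : 'rV[R]_n -> R)
    (F : 'rV[R]_n -> 'M[R]_(p, q)) y :
  differentiable c y -> mx_differentiable F y ->
  mx_differentiable (fun z => c z *: F z) y.
Proof. by move=> dc dF i j; under eq_fun do rewrite mxE; exact: differentiableM. Qed.

Lemma mx_differentiableD (p q : nat) (F G : 'rV[R]_n -> 'M[R]_(p, q)) y :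
  mx_differentiable F y -> mx_differentiable G y ->
  mx_differentiable (fun z => F z + G z) y.
Proof. by move=> dF dG i j; under eq_fun do rewrite mxE; exact: differentiableD. Qed.

Lemma mx_differentiable_cst (p q : nat) (A : 'M[R]_(p, q)) y :
  mx_differentiable (fun=> A) y.
Proof. by move=> i j; exact: differentiable_cst. Qed.

Lemma eq_on_pdmx (p q : nat) U (F G : 'rV[R]_n -> 'M[R]_(p, q)) y k :
  open U -> U y -> {in U, F =1 G} -> pdmx k F y = pdmx k G y.
Proof.
move=> oU Uy FG; apply/matrixP => i j; rewrite !pdmxE.
by apply: (eq_on_pd _ oU Uy) => z Uz; rewrite FG.
Qed.

Lemma pdmx_cst (p q : nat) (A : 'M[R]_(p, q)) y k : pdmx k (fun=> A) y = 0.
Proof. by apply/matrixP => i j; rewrite pdmxE mxE pd_cst. Qed.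

Lemma pdmxD (p q : nat) (F G : 'rV[R]_n -> 'M[R]_(p, q)) y k :
  mx_differentiable F y -> mx_differentiable G y ->
  pdmx k (fun z => F z + G z) y = pdmx k F y + pdmx k G y.
Proof.
move=> dF dG; apply/matrixP => i j; rewrite mxE !pdmxE.
by under [in LHS]eq_fun do rewrite mxE; rewrite pdD.
Qed.

Lemma pdmxM (p q r : nat) (F : 'rV[R]_n -> 'M[R]_(p, q))
    (G : 'rV[R]_n -> 'M[R]_(q, r)) y k :
  mx_differentiable F y -> mx_differentiable G y ->
  pdmx k (fun z => F z *m G z) y = pdmx k F y *m G y + F y *m pdmx k G y.
Proof.
move=> dF dG; apply/matrixP => i j; rewrite pdmxE !mxE.
under [in LHS]eq_fun do rewrite mxE; rewrite pd_sum; last first.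
  by move=> l; apply: differentiableM.
by rewrite -big_split; apply: eq_bigr => l _ /=; rewrite !pdmxE pdM.
Qed.

Lemma pdmx_scale (p q : nat) (c : 'rV[R]_n -> R)
    (F : 'rV[R]_n -> 'M[R]_(p, q)) y k :
  differentiable c y -> mx_differentiable F y ->
  pdmx k (fun z => c z *: F z) y = pd k c y *: F y + c y *: pdmx k F y.
Proof.
move=> dc dF; apply/matrixP => i j; rewrite !mxE !pdmxE.
by under [in LHS]eq_fun do rewrite mxE; rewrite pdM.
Qed.

Lemma pdmx_tr (p q : nat) (F : 'rV[R]_n -> 'M[R]_(p, q)) y k :
  pdmx k (fun z => (F z)^T) y = (pdmx k F y)^T.
Proof. by apply/matrixP => i j; rewrite mxE !pdmxE; under [in LHS]eq_fun do rewrite mxE. Qed.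

Lemma pd_mxtrace (F : 'rV[R]_n -> 'M[R]_n) y k :
  mx_differentiable F y -> pd k (fun z => \tr (F z)) y = \tr (pdmx k F y).
Proof.
by move=> dF; rewrite pd_sum//; apply: eq_bigr => i _; rewrite pdmxE.
Qed.

Lemma pdmx_comp (p q : nat) (h : 'rV[R]_n -> 'rV[R]_n)
    (F : 'rV[R]_n -> 'M[R]_(p, q)) y k :
  mx_differentiable h y -> mx_differentiable F (h y) ->
  pdmx k (F \o h) y = \sum_l Defs.jacobian h y l k *: pdmx l F (h y).
Proof.
move=> dh dF; apply/matrixP => i j; rewrite summxE pdmxE.
rewrite -[LHS]/(pd k ((fun z => F z i j) \o h) y) (pd_comp _ (dh 0) (dF i j)).
by apply: eq_bigr => l _; rewrite !mxE pdmxE mulrC.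
Qed.

Lemma smooth_mx_differentiable (p q : nat) U (F : 'rV[R]_n -> 'M[R]_(p, q)) y :
  smooth_mx_on U F -> U y -> mx_differentiable F y.
Proof. by move=> sF Uy i j; exact: smooth_differentiable (sF i j) Uy. Qed.

Lemma smooth_mx_pd (p q : nat) U (F : 'rV[R]_n -> 'M[R]_(p, q)) k :
  smooth_mx_on U F -> smooth_mx_on U (pdmx k F).
Proof.
move=> sF i j; have -> : (fun z => pdmx k F z i j) = pd k (fun z => F z i j).
  by apply/funext => z; rewrite pdmxE.
exact: smooth_pd (sF i j).
Qed.

Lemma pdmxC (p q : nat) U (F : 'rV[R]_n -> 'M[R]_(p, q)) y k l :
  open U -> smooth_mx_on U F -> U y ->
  pdmx k (pdmx l F) y = pdmx l (pdmx k F) y.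
Proof.
move=> oU sF Uy; apply/matrixP => i j.
have e (a : 'I_n) : (fun z => pdmx a F z i j) = pd a (fun z => F z i j).
  by apply/funext => z; rewrite pdmxE.
have E (a b : 'I_n) : pdmx a (pdmx b F) y i j = pd a (pd b (fun z => F z i j)) y.
  by rewrite pdmxE e.
have C := @pdC R n U (fun z => F z i j) y k l oU (sF i j) Uy.
exact (etrans (E k l) (etrans C (esym (E l k)))).
Qed.

Section Closure.
Variables (U : set 'rV[R]_n) (oU : open U).

Lemma eq_on_smooth_mx (p q : nat) (F G : 'rV[R]_n -> 'M[R]_(p, q)) :
  {in U, F =1 G} -> smooth_mx_on U F -> smooth_mx_on U G.
Proof. by move=> FG sF i j; apply: (eq_on_smooth oU _ (sF i j)) => z /FG ->. Qed.

Lemma smooth_mx_cst (p q : nat) (A : 'M[R]_(p, q)) : smooth_mx_on U (fun=> A).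
Proof. by move=> i j; exact: smooth_cst. Qed.

Lemma smooth_mxD (p q : nat) (F G : 'rV[R]_n -> 'M[R]_(p, q)) :
  smooth_mx_on U F -> smooth_mx_on U G -> smooth_mx_on U (fun z => F z + G z).
Proof. by move=> sF sG i j; under eq_fun do rewrite mxE; exact: smoothD. Qed.

Lemma smooth_mxM (p q r : nat) (F : 'rV[R]_n -> 'M[R]_(p, q))
    (G : 'rV[R]_n -> 'M[R]_(q, r)) :
  smooth_mx_on U F -> smooth_mx_on U G -> smooth_mx_on U (fun z => F z *m G z).
Proof.
move=> sF sG i j; under eq_fun do rewrite mxE.
by apply: smooth_sum => // l; exact: smoothM.
Qed.

Lemma smooth_mx_tr (p q : nat) (F : 'rV[R]_n -> 'M[R]_(p, q)) :
  smooth_mx_on U F -> smooth_mx_on U (fun z => (F z)^T).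
Proof. by move=> sF i j; under eq_fun do rewrite mxE; exact: sF. Qed.

Lemma smooth_mx_scale (p q : nat) (c : 'rV[R]_n -> R) (F : 'rV[R]_n -> 'M[R]_(p, q)) :
  smooth_on U c -> smooth_mx_on U F -> smooth_mx_on U (fun z => c z *: F z).
Proof. by move=> sc sF i j; under eq_fun do rewrite mxE; exact: smoothM. Qed.

Lemma smooth_mx_block (p1 p2 q1 q2 : nat) (A : 'rV[R]_n -> 'M[R]_(p1, q1)) B C
    (D : 'rV[R]_n -> 'M[R]_(p2, q2)) :
  smooth_mx_on U A -> smooth_mx_on U B -> smooth_mx_on U C -> smooth_mx_on U D ->
  smooth_mx_on U (fun z => block_mx (A z) (B z) (C z) (D z)).
Proof.
move=> sA sB sC sD i j.
case: (split_ordP i) => i' ->; case: (split_ordP j) => j' ->.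
- by under eq_fun do rewrite block_mxEul; exact: sA.
- by under eq_fun do rewrite block_mxEur; exact: sB.
- by under eq_fun do rewrite block_mxEdl; exact: sC.
- by under eq_fun do rewrite block_mxEdr; exact: sD.
Qed.

Lemma smooth_det (p : nat) (F : 'rV[R]_n -> 'M[R]_p) :
  smooth_mx_on U F -> smooth_on U (fun z => \det (F z)).
Proof.
move=> sF; rewrite /determinant; apply: smooth_sum => // s.
apply: smoothM => //; first exact: smooth_cst.
by apply: smooth_prod => // i; exact: sF.
Qed.

Lemma smooth_invmx (p : nat) (F : 'rV[R]_n -> 'M[R]_p) :
  (forall y, U y -> F y \in unitmx) ->
  smooth_mx_on U F -> smooth_mx_on U (fun z => invmx (F z)).
Proof.
move=> uF sF; apply: (@eq_on_smooth_mx _ _ (fun z => (\det (F z))^-1 *: \adj (F z))).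
  by move=> z; rewrite inE => Uz; rewrite /invmx uF.
apply: smooth_mx_scale.
  apply: smoothV => //; last exact: smooth_det.
  by move=> y /uF; rewrite unitmxE unitfE.
move=> i j; under eq_fun do rewrite mxE /cofactor.
apply: smoothM => //; first exact: smooth_cst.
by apply: smooth_det => a b; under eq_fun do rewrite !mxE; exact: sF.
Qed.

End Closure.

(** Both sides are the sum over i of the determinants of [F] with its i-th row differentiated:
    Laplace expansion along that row produces the adjugate, and the Leibniz rule in each permutation
    produces the derivative of the determinant. *)
Lemma pd_det_Jacobi (F : 'rV[R]_n -> 'M[R]_n) y k : mx_differentiable F y ->
  pd k (fun z => \det (F z)) y = \tr (\adj (F y) *m pdmx k F y).
Proof.
move=> dF; rewrite /determinant pd_sum; last first.
  move=> s; apply: differentiableM; first exact: differentiable_cst.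
  by apply: differentiable_prod => i; exact: dF.
pose Fi i := \matrix_(a, b) (if a == i then pdmx k F y a b else F y a b).
have -> : \tr (\adj (F y) *m pdmx k F y) = \sum_i \det (Fi i).
  rewrite mxtrace_mulC; apply: eq_bigr => i _.
  rewrite mxE (expand_det_row _ i); apply: eq_bigr => j _.
  rewrite [\adj _ _ _]mxE [Fi i i j]mxE eqxx; congr (_ * (_ * \det _)).
  by apply/matrixP => a b; rewrite !mxE eq_sym (negPf (neq_lift _ _)).
rewrite exchange_big; apply: eq_bigr => s _.
rewrite pdM; last by apply: differentiable_prod => i; exact: dF.
  rewrite pd_cst mul0r add0r (pd_prod _ (index_enum_uniq _) (fun i => dF i _)).
  rewrite mulr_sumr; apply: eq_bigr => i _; congr (_ * _).
  rewrite [RHS](bigD1 i)//= !mxE eqxx pdmxE; congr (_ * _).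
  by apply: eq_bigr => j /negPf ji; rewrite !mxE ji.
exact: differentiable_cst.
Qed.

End MatrixCalculus.

Lemma addmxE (R : nmodType) (p q : nat) (A B : 'M[R]_(p, q)) i j :
  (A + B) i j = A i j + B i j.
Proof. by rewrite mxE. Qed.

Lemma oppmxE (R : zmodType) (p q : nat) (A : 'M[R]_(p, q)) i j :
  (- A) i j = - A i j.
Proof. by rewrite mxE. Qed.

Lemma scalemxE (R : pzRingType) (p q : nat) (c : R) (A : 'M[R]_(p, q)) i j :
  (c *: A) i j = c * A i j.
Proof. by rewrite mxE. Qed.

(** * Pointwise algebra of connections and curvature *)

Lemma outermxE (R : pzRingType) (p q : nat) (a : 'cV[R]_p) (b : 'cV[R]_q) i j :
  (a *m b^T) i j = a i 0 * b j 0.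
Proof. by rewrite mxE big_ord1 mxE. Qed.

(** * Koszul's formula: the torsion-free metric connection *)

Section KoszulAlgebra.
Context {R : realFieldType} {n : nat}.
Variables (G : 'M[R]_n) (D : 'I_n -> 'M[R]_n).
Hypotheses (Gsym : G^T = G) (Gunit : G \in unitmx) (Dsym : forall k, (D k)^T = D k).

(** Christoffel symbols of the first kind, when [D k] is the k-th derivative of the metric; the
    entry (l, j) is Gamma_{l k j}. *)
Definition lowered (D : 'I_n -> 'M[R]_n) k : 'M[R]_n :=
  \matrix_(l, j) (2^-1 * (D k l j + D j k l - D l k j)).

Definition koszul k : 'M[R]_n := invmx G *m lowered D k.

Lemma sym_mxE (A : 'M[R]_n) i j : A^T = A -> A i j = A j i.
Proof. by move=> {1}<-; rewrite mxE. Qed.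

Lemma mul_koszul k : G *m koszul k = lowered D k.
Proof. by rewrite mulKVmx. Qed.

Lemma koszulC k i j : koszul k i j = koszul j i k.
Proof.
rewrite !mxE; apply: eq_bigr => l _; rewrite !mxE; congr (_ * (_ * _)).
rewrite (sym_mxE l j (Dsym k)) (sym_mxE k l (Dsym j)) (sym_mxE k j (Dsym l)).
by rewrite [D k j l + _]addrC.
Qed.

Lemma koszul_compat k : D k = (koszul k)^T *m G + G *m koszul k.
Proof.
rewrite -[in X in X + _]Gsym -trmx_mul mul_koszul; apply/matrixP => i j.
rewrite !mxE (sym_mxE j i (Dsym k)) (sym_mxE k j (Dsym i)).
by rewrite (sym_mxE k i (Dsym j)); field.
Qed.

(** Compatibility and symmetry express each entry of G C_k through three entries of the [D], as in
    the fundamental lemma of Riemannian geometry. Its use is [gamma_transition], where it replaces a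
    computation with the inverse metric. *)
Lemma koszul_uniq (C : 'I_n -> 'M[R]_n) :
  (forall k i j, C k i j = C j i k) ->
  (forall k, D k = (C k)^T *m G + G *m C k) -> forall k, C k = koszul k.
Proof.
move=> Csym CD k; rewrite /koszul; suff <- : G *m C k = lowered D k by rewrite mulKmx.
have Lsym a i j : (G *m C a) i j = (G *m C j) i a.
  by rewrite !mxE; apply: eq_bigr => l _; rewrite Csym.
have DE a i j : D a i j = (G *m C a) j i + (G *m C a) i j.
  by rewrite CD -[in X in X + _]Gsym -trmx_mul addmxE [_^T _ _]mxE.
apply/matrixP => l j; rewrite [RHS]mxE !DE.
by rewrite (Lsym j k l) (Lsym j l k) (Lsym l j k); field.
Qed.

End KoszulAlgebra.

(** * Symmetries of the curvature tensor *)

Section CurvatureAlgebra.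
Context {R : realFieldType} {n : nat}.
Variables (G : 'M[R]_n) (D C : 'I_n -> 'M[R]_n) (H dC : 'I_n -> 'I_n -> 'M[R]_n).
Hypotheses (Gsym : G^T = G) (Gunit : G \in unitmx) (Hsym : forall l k, (H l k)^T = H l k).
Hypothesis HC : forall l k, H l k = H k l.
Hypothesis Csym : forall k i j, C k i j = C j i k.
Hypothesis CD : forall k, D k = (C k)^T *m G + G *m C k.
Hypothesis dCE : forall l k, D l *m C k + G *m dC l k = lowered (H l) k.

(* [H l k] and [dC l k] play the role of the derivatives of [D k] and [C k] in
   the [l]-th direction. *)
Definition curv (C : 'I_n -> 'M[R]_n) (dC : 'I_n -> 'I_n -> 'M[R]_n) l k : 'M[R]_n :=
  dC l k - dC k l + C l *m C k - C k *m C l.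

Local Notation Rm := (curv C dC).

Lemma curvC l k : Rm l k = - Rm k l.
Proof. by rewrite /curv; apply/matrixP => i j; rewrite !(addmxE, oppmxE); ring. Qed.

(** Replacing G dC by means of [dCE] and D by means of [CD] leaves the second derivatives of the
    metric and terms quadratic in the Christoffel symbols, the form in which pair symmetry can be
    read off. *)
Lemma mul_curv l k : G *m Rm l k = lowered (H l) k - lowered (H k) l
  - (C l)^T *m G *m C k + (C k)^T *m G *m C l.
Proof.
rewrite -!dCE !CD /curv !(mulmxDl, mulmxBr, mulmxDr) !mulmxA.
by apply/matrixP => i j; rewrite !(addmxE, oppmxE); ring.
Qed.

Lemma curv_pair l k j i : (G *m Rm l k) j i = (G *m Rm j i) l k.
Proof.
(* [Q a b c d] is g(Gamma(a, b), Gamma(c, d)): symmetric within each pair and under exchange of the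
   pairs. The quadratic terms therefore have pair symmetry on their own, as do the second
   derivatives [H]. *)
pose Q a b c d := ((C a)^T *m G *m C c) b d.
have Qtr a b c d : Q a b c d = Q c d a b.
  rewrite /Q -[in RHS]Gsym -mulmxA -[RHS]/((_ *m _) d b).
  by rewrite -[in RHS](trmxK (C a)) -mulmxA -!trmx_mul [RHS]mxE mulmxA.
have Ql a b c d : Q a b c d = Q b a c d.
  rewrite /Q mxE [RHS]mxE; apply: eq_bigr => m _; congr (_ * _).
  by rewrite mxE [RHS]mxE; apply: eq_bigr => m' _; rewrite mxE [in RHS]mxE Csym.
have Qr a b c d : Q a b c d = Q a b d c by rewrite Qtr Ql Qtr.
have e l' k' j' i' : (G *m Rm l' k') j' i' =
    lowered (H l') k' j' i' - lowered (H k') l' j' i' - Q l' j' k' i' + Q k' j' l' i'.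
  by rewrite mul_curv !(addmxE, oppmxE).
rewrite !e (Ql j l) (Qr l j i k) (Qtr k j l i) (Ql l i k j) (Qr i l k j).
rewrite !mxE (HC k l) (HC i j) (HC l i) (HC l j) (HC k i) (HC k j).
rewrite (sym_mxE k j (Hsym i l)) (sym_mxE k i (Hsym j l)).
rewrite (sym_mxE l j (Hsym i k)) (sym_mxE l i (Hsym j k)); ring.
Qed.

(** Pair symmetry carries the antisymmetry in [l], [k] over to the matrix indices, so R_lk is the
    product of the symmetric matrix G^-1 and a skew one. This is what makes the connection on
    densities flat. *)
Lemma mxtrace_curv l k : \tr (Rm l k) = 0.
Proof.
have tA : (G *m Rm l k)^T = - (G *m Rm l k).
  apply/matrixP => i j; rewrite mxE oppmxE curv_pair curvC mulmxN oppmxE.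
  by rewrite -curv_pair.
suff : \tr (Rm l k) = - \tr (Rm l k) by move=> e; lra.
rewrite -{1}(mulKmx Gunit (Rm l k)) -mxtrace_tr trmx_mul tA mulNmx raddfN.
by rewrite trmx_inv Gsym /= mxtrace_mulC mulKmx.
Qed.

End CurvatureAlgebra.

(** * Curvature in the direction of a nullity vector *)

Section NullityAlgebra.
Context {R : realFieldType} {n : nat} (n2 : (2 <= n)%N).
Variables (G : 'M[R]_n) (Rm : 'I_n -> 'I_n -> 'M[R]_n) (P : 'M[R]_n).
Hypotheses (Gsym : G^T = G) (Gunit : G \in unitmx).
Hypothesis Rm_pair : forall l k j i, (G *m Rm l k) j i = (G *m Rm j i) l k.
Hypothesis PE : forall j k, P j k = (\sum_i Rm i k i j) / (n%:R - 1).
Variables (v : 'cV[R]_n) (B : R).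
Hypothesis v0 : v != 0.
Hypothesis Wv : forall i k l,
  \sum_j (Rm k l i j + (i == l)%:R * P j k - (i == k)%:R * P j l) * v j 0 = 0.
Hypothesis Pv : forall i, \sum_j (\sum_k invmx G i k * P k j) * v j 0 = B * v i 0.

Local Notation e_ k := (delta_mx k 0 : 'cV[R]_n).

(** After lowering an index, [Rm_pair] exchanges j and k at the price of exchanging the two indices
    contracted with G^-1, which is symmetric. *)
Lemma schouten_sym j k : P j k = P k j.
Proof.
rewrite !PE; congr (_ / _).
have E (i a b c : 'I_n) : Rm a b i c = \sum_m invmx G i m * (G *m Rm a b) m c.
  by rewrite -[in LHS](mulKmx Gunit (Rm a b)) mxE.
under eq_bigr do rewrite E; under [RHS]eq_bigr do rewrite E.
rewrite exchange_big; apply: eq_bigr => i _; apply: eq_bigr => m _.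
rewrite Rm_pair; congr (_ * _).
by apply: sym_mxE; rewrite trmx_inv Gsym.
Qed.

(** Solving [Wv] for the curvature leaves contractions of v with the first index of P, whereas [Pv]
    controls the second; [schouten_sym] reconciles the two and turns both into B G v. *)
Lemma curv_nullity k l :
  Rm k l *m v = B *: ((G *m v) l 0 *: e_ k - (G *m v) k 0 *: e_ l).
Proof.
have PvE : P *m v = B *: (G *m v).
  apply: (can_inj (mulKmx (etrans (unitmx_inv G) Gunit))).
  rewrite -scalemxAr mulKmx//; apply/matrixP => i j; rewrite (ord1 j) mulmxA [RHS]mxE -Pv mxE.
  by apply: eq_bigr => m _; rewrite [in LHS]mxE.
have Pvk a : \sum_j P j a * v j 0 = B * (G *m v) a 0.
  by rewrite -scalemxE -PvE mxE; apply: eq_bigr => j _; rewrite schouten_sym.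
apply/matrixP => i j; rewrite (ord1 j) mxE.
have := Wv i k l.
under eq_bigr do rewrite mulrBl mulrDl -!(mulrA _ (P _ _)).
rewrite sumrB big_split/= -!mulr_sumr !Pvk => /eqP.
rewrite subr_eq add0r -eq_sym -subr_eq => /eqP <-.
rewrite scalemxE addmxE oppmxE !scalemxE !mxE eqxx !andbT; ring.
Qed.

Lemma contracted_curv l :
  \sum_k v k 0 *: Rm l k = B *: (e_ l *m (v^T *m G) - v *m ((e_ l)^T *m G)).
Proof.
apply: (can_inj (mulKmx Gunit)); apply/matrixP => j i.
have -> : (G *m \sum_k v k 0 *: Rm l k) j i = (G *m (Rm j i *m v)) l 0.
  rewrite mulmxA [RHS]mxE mulmx_sumr summxE; apply: eq_bigr => k _.
  by rewrite -scalemxAr scalemxE Rm_pair mulrC.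
rewrite curv_nullity -!scalemxAr !scalemxE; congr (_ * _).
have tG (u : 'cV[R]_n) : u^T *m G = (G *m u)^T by rewrite trmx_mul Gsym.
rewrite !tG !mulmxBr -!scalemxAr !(addmxE, oppmxE, scalemxE) !mulmxA !outermxE.
have c a b : (G *m e_ a) b 0 = G b a by rewrite -colE mxE.
by rewrite !c (sym_mxE l i Gsym) (sym_mxE l j Gsym); ring.
Qed.

End NullityAlgebra.

(** * Consequences of contracting the integrability conditions with the nullity vector *)

Section ContractionAlgebra.
Context {R : realFieldType} {n : nat} (n2 : (2 <= n)%N).
Variables (G : 'M[R]_n) (Rm : 'I_n -> 'I_n -> 'M[R]_n).
Variables (v : 'cV[R]_n) (B : R).
Hypotheses (Gsym : G^T = G) (v0 : v != 0).
Local Notation e_ k := (delta_mx k 0 : 'cV[R]_n).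
Hypothesis Rv : forall l,
  \sum_k v k 0 *: Rm l k = B *: (e_ l *m (v^T *m G) - v *m ((e_ l)^T *m G)).

Let n0 : n%:R != 0 :> R.
Proof. by rewrite pnatr_eq0 -lt0n (ltn_trans _ n2). Qed.

Let ex_v : exists i, v i 0 != 0.
Proof.
apply: contraNP v0 => /forallNP v0'; apply/eqP/matrixP => i j.
by rewrite (ord1 j) mxE; apply/eqP; have /negP := v0' i; rewrite negbK.
Qed.

Lemma sum_deltamx (u : 'cV[R]_n) : \sum_k u k 0 *: e_ k = u.
Proof.
apply/matrixP => i j; rewrite (ord1 j) summxE (bigD1 i)//= big1 => [|k ki].
  by rewrite addr0 !mxE !eqxx mulr1.
by rewrite !mxE eq_sym (negPf ki) mulr0.
Qed.

Lemma sum_dirac (u : 'I_n -> R) i : \sum_k u k * (k == i)%:R = u i.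
Proof.
by rewrite (bigD1 i)//= eqxx mulr1 big1 ?addr0// => k /negPf ->; rewrite mulr0.
Qed.

(** Contracting [l] with one slot gives m = (t/n) v, where t is the trace of N. Then X = N_l - (t/n)
    e_l has zero symmetric product with v, and a symmetric product vanishes only if a factor
    does. *)
Lemma symmetric_product_scalar (N : 'I_n -> 'cV[R]_n) :
  (forall l, e_ l *m (\sum_k v k 0 *: N k)^T + (\sum_k v k 0 *: N k) *m (e_ l)^T =
             v *m (N l)^T + N l *m v^T) ->
  exists r, forall l, N l = r *: e_ l.
Proof.
set m := \sum_k _ => Nv; pose t := \sum_l N l l 0.
have E l b c : (b == l)%:R * m c 0 + m b 0 * (c == l)%:R = v b 0 * N l c 0 + N l b 0 * v c 0.
  have /matrixP/(_ b c) := Nv l.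
  by rewrite !addmxE !outermxE !mxE !eqxx !andbT.
have mE c : m c 0 = t / n%:R * v c 0.
  have : \sum_l ((l == l)%:R * m c 0 + m l 0 * (c == l)%:R) =
         \sum_l (v l 0 * N l c 0 + N l l 0 * v c 0) by apply: eq_bigr => l _; exact: E.
  have s1 : \sum_(l < n) (l == l)%:R * m c 0 = n%:R * m c 0.
    under eq_bigr do rewrite eqxx mul1r; by rewrite sumr_const card_ord mulr_natl.
  have s2 : \sum_l m l 0 * (c == l)%:R = m c 0.
    under eq_bigr do rewrite eq_sym; exact: sum_dirac.
  have s3 : \sum_l v l 0 * N l c 0 = m c 0.
    by rewrite /m summxE; apply: eq_bigr => l _; rewrite mxE.
  rewrite !big_split/= s1 s2 s3 -mulr_suml -/t.
  by move=> e; rewrite mulrAC; apply: (canRL (mulfK n0)); lra.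
exists (t / n%:R) => l; have [i vi] := ex_v.
pose X c := N l c 0 - t / n%:R * (c == l)%:R.
have XE b c : v b 0 * X c + v c 0 * X b = 0.
  have := E l b c; rewrite !mE /X => e; lra.
have Xi : X i = 0.
  have := XE i i; rewrite -mulr2n => /eqP; rewrite mulrn_eq0/= mulf_eq0 (negPf vi)/=.
  by move/eqP.
apply/matrixP => b j; rewrite (ord1 j) !mxE eqxx andbT; apply/eqP; rewrite -subr_eq0.
have /eqP := XE i b; rewrite Xi mulr0 addr0 mulf_eq0 (negPf vi)/=.
by rewrite /X.
Qed.

Lemma metrisability_contraction (S : 'M[R]_n) (N : 'I_n -> 'cV[R]_n) : S^T = S ->
  (forall l k, Rm l k *m S + S *m (Rm l k)^T =
     e_ l *m (N k)^T + N k *m (e_ l)^T - (e_ k *m (N l)^T + N l *m (e_ k)^T)) ->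
  exists r, forall l, N l = r *: e_ l + B *: (S *m (G *m e_ l)).
Proof.
move=> Ssym RS.
(* This shift absorbs the right-hand side of [Rv], so that the [N'] satisfy the hypothesis of
   [symmetric_product_scalar] with no curvature left. *)
pose N' k := N k - B *: (S *m (G *m e_ k)).
suff [r Nr] : exists r, forall l, N' l = r *: e_ l.
  by exists r => l; rewrite -Nr subrK.
apply: symmetric_product_scalar => l.
pose m := \sum_k v k 0 *: N k.
have -> : \sum_k v k 0 *: N' k = m - B *: (S *m (G *m v)).
  rewrite /N'; under eq_bigr do rewrite scalerBr; rewrite sumrB; congr (_ - _).
  rewrite -{2}(sum_deltamx v) !mulmx_sumr scaler_sumr; apply: eq_bigr => k _.
  by rewrite -!scalemxAr !scalerA mulrC.
have : (\sum_k v k 0 *: Rm l k) *m S + S *m (\sum_k v k 0 *: Rm l k)^T =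
   e_ l *m m^T + m *m (e_ l)^T - (v *m (N l)^T + N l *m v^T).
  rewrite linear_sum/= mulmx_suml mulmx_sumr -big_split/=.
  transitivity (\sum_k v k 0 *: (Rm l k *m S + S *m (Rm l k)^T)).
    by apply: eq_bigr => k _; rewrite linearZ/= scalerDr scalemxAl scalemxAr.
  rewrite -{2 3}(sum_deltamx v) /m.
  rewrite !(linear_sum, mulmx_suml, mulmx_sumr) /= -!big_split/= -sumrB.
  apply: eq_bigr => k _; rewrite RS.
  by rewrite !linearZ/= -?scalemxAl -?scalemxAr scalerBr !scalerDr.
rewrite Rv /N'; set p := S *m (G *m v); set q := S *m (G *m e_ l).
have pT : v^T *m G *m S = p^T by rewrite !trmx_mul Gsym Ssym.
have qT : (e_ l)^T *m G *m S = q^T by rewrite !trmx_mul Gsym Ssym.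
rewrite linearZ/= -scalemxAr -scalemxAl -scalerDr.
rewrite linearB/= !trmx_mul !trmxK Gsym mulmxBl mulmxBr !mulmxA.
rewrite -(mulmxA (e_ l *m _)) -(mulmxA (v *m _)).
rewrite -!(mulmxA (e_ l)) -!(mulmxA v) !(mulmxA _ G) pT qT.
move=> /matrixP e; apply/matrixP => b c; have := e b c.
have {}pT : S *m G *m v = p by rewrite -mulmxA.
have {}qT : S *m G *m e_ l = q by rewrite -mulmxA.
rewrite pT qT !(addmxE, oppmxE, scalemxE, outermxE) => {}e.
lra.
Qed.

(** With T = t - B G u, contracting [Ru] with v gives v_b T_l = (v . T) delta_bl. Its trace reads v
    . T = n (v . T), so v . T = 0 because n > 1, and a nonzero entry of v then forces T = 0. *)
Lemma divergence_contraction (u : 'cV[R]_n) (t : 'I_n -> R) :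
  (forall l k, Rm l k *m u = t k *: e_ l - t l *: e_ k) ->
  forall l, t l = B * ((e_ l)^T *m G *m u) 0 0.
Proof.
move=> Ru; pose w := G *m u; pose T k := t k - B * w k 0.
have wE k : ((e_ k)^T *m G *m u) 0 0 = w k 0.
  by rewrite -mulmxA mxE (bigD1 k)//= big1 => [|i ik];
    rewrite !mxE ?eqxx ?mul1r ?addr0// (negPf ik) mul0r.
have vE : (v^T *m G *m u) 0 0 = \sum_k v k 0 * w k 0.
  by rewrite -mulmxA mxE; apply: eq_bigr => k _; rewrite mxE.
suff T0 : forall l, T l = 0.
  by move=> l; rewrite wE; apply/eqP; rewrite -subr_eq0; apply/eqP/T0.
move=> l; have E b l0 : v b 0 * T l0 = (\sum_k v k 0 * T k) * (b == l0)%:R.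
  move: l0 => {}l.
  have : ((\sum_k v k 0 *: Rm l k) *m u) b 0 =
         (b == l)%:R * (\sum_k v k 0 * t k) - v b 0 * t l.
    rewrite mulmx_suml summxE mulr_sumr.
    have -> : v b 0 * t l = \sum_k (v k 0 * t l) * (b == k)%:R.
      by under eq_bigr do rewrite eq_sym; rewrite sum_dirac.
    rewrite -sumrB; apply: eq_bigr => k _.
    by rewrite -scalemxAl Ru !(scalemxE, addmxE, oppmxE) !mxE eqxx !andbT; ring.
  rewrite Rv -scalemxAl scalemxE mulmxBl addmxE oppmxE -!(mulmxA _ _ u).
  rewrite [X in X - _]mxE [X in _ - X]mxE !big_ord1 (mulmxA v^T) (mulmxA (_ ^T)).
  rewrite vE wE mxE eqxx andbT => e.
  have -> : \sum_k v k 0 * T k = \sum_k v k 0 * t k - B * \sum_k v k 0 * w k 0.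
    by rewrite mulr_sumr -sumrB; apply: eq_bigr => k _; rewrite /T; ring.
  by rewrite /T; lra.
have Tv0 : \sum_k v k 0 * T k = 0.
  have : \sum_k v k 0 * T k = n%:R * \sum_k v k 0 * T k.
    transitivity (\sum_(k < n) \sum_k v k 0 * T k).
      by apply: eq_bigr => k _; rewrite E eqxx mulr1.
    by rewrite sumr_const card_ord mulr_natl.
  set x := \sum_k _ => e; have : (n%:R - 1) * x = 0 by lra.
  move=> /eqP; rewrite mulf_eq0 subr_eq0 pnatr_eq1 => /orP[/eqP n1|/eqP//].
  by move: n2; rewrite n1.
have [i vi] := ex_v; have /eqP := E i l.
by rewrite Tv0 mul0r mulf_eq0 (negPf vi) => /eqP.
Qed.

End ContractionAlgebra.

(** * Ricci identities *)

Lemma trmx_addE (R : nmodType) (p q : nat) (A B : 'M[R]_(p, q)) :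
  (A + B)^T = A^T + B^T.
Proof. by apply/matrixP => i j; rewrite !mxE. Qed.

Lemma trmx_oppE (R : zmodType) (p q : nat) (A : 'M[R]_(p, q)) : (- A)^T = - A^T.
Proof. by apply/matrixP => i j; rewrite !mxE. Qed.

Lemma trmx_scaleE (R : pzRingType) (p q : nat) (c : R) (A : 'M[R]_(p, q)) :
  (c *: A)^T = c *: A^T.
Proof. by apply/matrixP => i j; rewrite !mxE. Qed.

Section CovariantDerivatives.
Context {R : realType} {n : nat}.
Variables (U : set 'rV[R]_n) (oU : open U).
Variables (C : 'I_n -> 'rV[R]_n -> 'M[R]_n).
Hypothesis sC : forall k, smooth_mx_on U (C k).
Hypothesis Csym : forall y, U y -> forall k i j, C k y i j = C j y i k.
Variable c : 'I_n -> 'rV[R]_n -> R.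
Hypothesis sc : forall k, smooth_on U (c k).

(** The index [k] is a label and is not itself differentiated covariantly: the omitted terms
    Gamma^m_{lk} nabla_m are symmetric in l and k, so they would cancel in every commutator formed
    below. The 1-form [c] is the weight times the connection form of E(1). *)
Definition covTM k (mu : 'rV[R]_n -> 'cV[R]_n) y : 'cV[R]_n :=
  pdmx k mu y + c k y *: mu y + C k y *m mu y.

Definition covS k (s : 'rV[R]_n -> 'M[R]_n) y : 'M[R]_n :=
  pdmx k s y + c k y *: s y + C k y *m s y + s y *m (C k y)^T.

Local Notation Rm y := (curv (fun k => C k y) (fun l k => pdmx l (C k) y)).
Hypothesis cclosed : forall y, U y -> forall l k, pd l (c k) y = pd k (c l) y.
Local Notation e_ k := (delta_mx k 0 : 'cV[R]_n).

Lemma smooth_covTM k mu : smooth_mx_on U mu -> smooth_mx_on U (covTM k mu).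
Proof.
move=> smu; apply: smooth_mxD => //; last exact: smooth_mxM.
by apply: smooth_mxD => //; [exact: smooth_mx_pd|exact: smooth_mx_scale].
Qed.

Lemma smooth_covS k s : smooth_mx_on U s -> smooth_mx_on U (covS k s).
Proof.
move=> ss; apply: smooth_mxD => //.
  apply: smooth_mxD => //; last exact: smooth_mxM.
  by apply: smooth_mxD => //; [exact: smooth_mx_pd|exact: smooth_mx_scale].
by apply: smooth_mxM => //; exact: smooth_mx_tr.
Qed.

(** The derivatives of [c] cancel by closedness, so the weight of [mu] leaves no trace and only the
    curvature of [C] survives. *)
Lemma ricci_TM mu y l k : smooth_mx_on U mu -> U y ->
  covTM l (covTM k mu) y - covTM k (covTM l mu) y = Rm y l k *m mu y.
Proof.
move=> smu Uy.
have D1 := smooth_mx_differentiable smu Uy.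
have D2 a := smooth_mx_differentiable (smooth_mx_pd a smu) Uy.
have D3 a := smooth_mx_differentiable (sC a) Uy.
have D4 a : differentiable (c a) y := smooth_differentiable (sc a) Uy.
have D5 a := mx_differentiable_scale (D4 a) D1.
have D6 a := mx_differentiable_mul (D3 a) D1.
have D7 a := mx_differentiableD (D2 a) (D5 a).
have E a b : pdmx a (covTM b mu) y =
    pdmx a (pdmx b mu) y + (pd a (c b) y *: mu y + c b y *: pdmx a mu y)
    + (pdmx a (C b) y *m mu y + C b y *m pdmx a mu y).
  by rewrite (pdmxD _ (D7 b) (D6 b)) (pdmxD _ (D2 b) (D5 b)) pdmx_scale// pdmxM.
rewrite /(covTM l (covTM k mu)) /(covTM k (covTM l mu)) !E (pdmxC k l oU smu Uy).
rewrite (cclosed Uy k l) /(covTM _ mu) /curv.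
move: (pdmx l (pdmx k mu) y) (pd l (c k) y) (pdmx k mu y) (pdmx l mu y).
move: (c k y) (c l y) (pdmx l (C k) y) (pdmx k (C l) y) (C l y) (C k y) (mu y).
move=> ck' cl' dlC dkC Cl Ck m ddm dc dkm dlm.
rewrite !(mulmxDl, mulmxDr, mulNmx, scalerDr, mulmxA) -!scalemxAr.
by apply/matrixP => i j; rewrite !(addmxE, oppmxE, scalemxE); ring.
Qed.

Lemma ricci_S s y l k : smooth_mx_on U s -> U y ->
  covS l (covS k s) y - covS k (covS l s) y = Rm y l k *m s y + s y *m (Rm y l k)^T.
Proof.
move=> ss Uy.
have D1 := smooth_mx_differentiable ss Uy.
have D2 a := smooth_mx_differentiable (smooth_mx_pd a ss) Uy.
have D3 a := smooth_mx_differentiable (sC a) Uy.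
have D3' a := mx_differentiable_tr (D3 a).
have D4 a : differentiable (c a) y := smooth_differentiable (sc a) Uy.
have D5 a := mx_differentiable_scale (D4 a) D1.
have D6 a := mx_differentiable_mul (D3 a) D1.
have D6' a := mx_differentiable_mul D1 (D3' a).
have D7 a := mx_differentiableD (D2 a) (D5 a).
have D8 a := mx_differentiableD (D7 a) (D6 a).
have E a b : pdmx a (covS b s) y =
    pdmx a (pdmx b s) y + (pd a (c b) y *: s y + c b y *: pdmx a s y)
    + (pdmx a (C b) y *m s y + C b y *m pdmx a s y)
    + (pdmx a s y *m (C b y)^T + s y *m (pdmx a (C b) y)^T).
  rewrite (pdmxD _ (D8 b) (D6' b)) (pdmxD _ (D7 b) (D6 b)) (pdmxD _ (D2 b) (D5 b)).
  by rewrite pdmx_scale// pdmxM// (pdmxM _ D1 (D3' b)) pdmx_tr.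
rewrite /(covS l (covS k s)) /(covS k (covS l s)) !E (pdmxC k l oU ss Uy).
rewrite (cclosed Uy k l) /(covS _ s) /curv.
move: (pdmx l (pdmx k s) y) (pd l (c k) y) (pdmx k s y) (pdmx l s y).
move: (c k y) (c l y) (pdmx l (C k) y) (pdmx k (C l) y) (C l y) (C k y) (s y).
move=> ck' cl' dlC dkC Cl Ck m ddm dc dkm dlm.
rewrite !(trmx_addE, trmx_oppE, trmx_mul).
rewrite !(mulmxDl, mulmxDr, mulNmx, mulmxN, scalerDr, mulmxA) -!scalemxAr -!scalemxAl.
by apply/matrixP => i j; rewrite !(addmxE, oppmxE, scalemxE); ring.
Qed.

Lemma Csym_mul y k l : U y -> C l y *m e_ k = C k y *m e_ l.
Proof.
move=> Uy; rewrite -!colE; apply/matrixP => i j; rewrite !mxE; exact: Csym.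
Qed.

(* Antisymmetrising a second derivative of the equation
   [nabla_k s = - (e_k mu + mu e_k)]: the Ricci identity turns the left-hand side
   into curvature, and the terms in [C l e_k = C k e_l] cancel. *)
Lemma metrisability_integrability s mu : smooth_mx_on U s -> smooth_mx_on U mu ->
  (forall y, U y -> forall k, covS k s y = - (e_ k *m (mu y)^T + mu y *m (e_ k)^T)) ->
  forall y, U y -> forall l k,
  Rm y l k *m s y + s y *m (Rm y l k)^T =
    e_ l *m (covTM k mu y)^T + covTM k mu y *m (e_ l)^T
    - (e_ k *m (covTM l mu y)^T + covTM l mu y *m (e_ k)^T).
Proof.
move=> ss smu eqs y Uy l k; rewrite -(ricci_S _ _ ss Uy).
have D1 := smooth_mx_differentiable smu Uy.
have D1' := mx_differentiable_tr D1.
have De b := mx_differentiable_cst (e_ b) y.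
have De' b := mx_differentiable_cst (e_ b)^T y.
have E a b : covS a (covS b s) y =
    - (e_ b *m (covTM a mu y)^T + covTM a mu y *m (e_ b)^T)
    - (C a y *m e_ b *m (mu y)^T + mu y *m (C a y *m e_ b)^T).
  rewrite {1}/covS eqs//.
  have -> : pdmx a (covS b s) y = - (e_ b *m (pdmx a mu y)^T + pdmx a mu y *m (e_ b)^T).
    rewrite (@eq_on_pdmx _ _ _ _ U _ (fun z => -1 *: (e_ b *m (mu z)^T + mu z *m (e_ b)^T)))//.
      have D2 := mx_differentiable_mul (De b) D1'.
      have D3 := mx_differentiable_mul D1 (De' b).
      rewrite pdmx_scale ?pd_cst; [|exact: differentiable_cst|exact: mx_differentiableD].
      rewrite (pdmxD _ D2 D3) pdmxM// (pdmxM _ D1 (De' b)) !pdmx_cst pdmx_tr.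
      by rewrite mul0mx mulmx0 scale0r !add0r addr0 scaleN1r.
    by move=> z; rewrite inE => Uz; rewrite eqs// scaleN1r.
  rewrite /covTM; move: (pdmx a mu y) (c a y) (C a y) (mu y) => dm ca Ca m.
  rewrite !(trmx_addE, trmx_scaleE, trmx_mul).
  rewrite !(mulmxDl, mulmxDr, mulNmx, mulmxN, scalerDr, mulmxA) -?scalemxAr -?scalemxAl.
  by apply/matrixP => i j; rewrite !(addmxE, oppmxE, scalemxE); ring.
rewrite !E (Csym_mul k l Uy).
by apply/matrixP => i j; rewrite !(addmxE, oppmxE, scalemxE); ring.
Qed.

Variables (G : 'rV[R]_n -> 'M[R]_n).
Hypotheses (sG : smooth_mx_on U G) (Gsym : forall y, U y -> (G y)^T = G y).
Hypothesis CG : forall y, U y -> forall k,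
  pdmx k G y = (C k y)^T *m G y + G y *m C k y.

(** Because G is parallel, differentiating B s G e_k only brings in the derivative of s, that is -B
    (e_l mu^T + mu e_l^T) G e_k. Its first summand is a multiple of e_l and joins the derivative of
    rho in [t]; the second has the coefficient e_l^T G e_k, symmetric in l and k, and cancels. *)
Lemma divergence_integrability (B : R) s mu rho :
  smooth_mx_on U s -> smooth_mx_on U mu -> smooth_on U rho ->
  (forall y, U y -> (s y)^T = s y) ->
  (forall y, U y -> forall k, covS k s y = - (e_ k *m (mu y)^T + mu y *m (e_ k)^T)) ->
  (forall y, U y -> forall k,
     covTM k mu y = - rho y *: e_ k + B *: (s y *m (G y *m e_ k))) ->
  forall y, U y -> forall l k,
  let t k := pd k rho y + c k y * rho y - B * ((e_ k)^T *m G y *m mu y) 0 0 in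
  Rm y l k *m mu y = t k *: e_ l - t l *: e_ k.
Proof.
move=> ss smu srho ssym eqs eqmu y Uy l k t; rewrite -(ricci_TM _ _ smu Uy).
have D1 := smooth_mx_differentiable ss Uy.
have D2 := smooth_mx_differentiable sG Uy.
have De b := mx_differentiable_cst (e_ b) y.
have D3 b := mx_differentiable_mul D2 (De b).
have D4 b := mx_differentiable_mul D1 (D3 b).
have Dr := smooth_differentiable srho Uy.
have scal (X : 'cV[R]_n) (A : 'rV[R]_n) (M : 'M[R]_n) (v : 'cV[R]_n) :
    X *m A *m M *m v = (A *m M *m v) 0 0 *: X.
  by rewrite -!mulmxA [in LHS](mx11_scalar (A *m _)) mul_mx_scalar.
have swap (v w : 'cV[R]_n) : (v^T *m G y *m w) 0 0 = (w^T *m G y *m v) 0 0.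
  by rewrite -[in LHS](trmxK (_ *m w)) [in LHS]mxE !trmx_mul trmxK (Gsym Uy) mulmxA.
have E a b : covTM a (covTM b mu) y =
    - (pd a rho y + c a y * rho y) *: e_ b - rho y *: (C a y *m e_ b)
    + B *: (s y *m G y *m (C a y *m e_ b)
            - ((e_ b)^T *m G y *m mu y) 0 0 *: e_ a
            - ((e_ a)^T *m G y *m e_ b) 0 0 *: mu y).
  rewrite {1}/covTM eqmu//.
  have -> : pdmx a (covTM b mu) y = - pd a rho y *: e_ b
      + B *: (pdmx a s y *m (G y *m e_ b) + s y *m (pdmx a G y *m e_ b)).
    rewrite (@eq_on_pdmx _ _ _ _ U _
      (fun z => rho z *: (- e_ b) + B *: (s z *m (G z *m e_ b))))//; last first.
      by move=> z; rewrite inE => Uz; rewrite eqmu// scalerN scaleNr.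
    have D5 := mx_differentiable_scale Dr (mx_differentiable_cst (- e_ b) y).
    have DB : differentiable (fun _ : 'rV[R]_n => B) y by exact: differentiable_cst.
    rewrite (pdmxD _ D5 (mx_differentiable_scale DB (D4 b))).
    rewrite (pdmx_scale _ Dr (mx_differentiable_cst _ _)) (pdmx_scale _ DB (D4 b)).
    rewrite (pdmxM _ D1 (D3 b)) (pdmxM _ D2 (De b)) !pdmx_cst pd_cst.
    by rewrite scaler0 scale0r mulmx0 !addr0 add0r scalerN scaleNr.
  have -> : pdmx a s y = - (e_ a *m (mu y)^T + mu y *m (e_ a)^T)
      - c a y *: s y - C a y *m s y - s y *m (C a y)^T.
    by rewrite -eqs// /covS; apply/matrixP => i j; rewrite !(addmxE, oppmxE, scalemxE); ring.
  rewrite CG//.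
  rewrite !(mulmxDl, mulmxDr, mulNmx, mulmxN, scalerDr, mulmxA) -?scalemxAr -?scalemxAl.
  rewrite !scal (swap _ (mu y)).
  move: (((e_ b)^T *m G y *m mu y) 0 0) (((e_ a)^T *m G y *m e_ b) 0 0) => x1 x2.
  rewrite -?scalemxAr -?scalemxAl !mulmxA.
  move: (pd a rho y) (c a y) (C a y) (mu y) (s y) (G y) (rho y) => dr ca Ca m S g r.
  by apply/matrixP => i j; rewrite !(addmxE, oppmxE, scalemxE); ring.
rewrite !E (Csym_mul k l Uy) /t (swap (e_ k) (e_ l)).
move: (((e_ k)^T *m G y *m mu y) 0 0) (((e_ l)^T *m G y *m mu y) 0 0).
move: (((e_ l)^T *m G y *m e_ k) 0 0) (pd l rho y) (pd k rho y) => x1 x2 x3 x4 x5.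
by apply/matrixP => i j; rewrite !(addmxE, oppmxE, scalemxE); ring.
Qed.

End CovariantDerivatives.

Lemma pd_koszul_term (R : realType) (n : nat) (l : 'I_n) (f1 f2 f3 : 'rV[R]_n -> R) y :
  differentiable f1 y -> differentiable f2 y -> differentiable f3 y ->
  pd l (fun z => 2^-1 * (f1 z + f2 z - f3 z)) y = 2^-1 * (pd l f1 y + pd l f2 y - pd l f3 y).
Proof.
move=> d1 d2 d3; have d12 := differentiableD d1 d2.
rewrite pdM; [|exact: differentiable_cst|exact: differentiableB d12 d3].
by rewrite pd_cst mul0r add0r (pdB _ d12 d3) pdD.
Qed.

Lemma pdmx_sym (R : realType) (n p : nat) k (F : 'rV[R]_n -> 'M[R]_p) y :
  (forall z, (F z)^T = F z) -> (pdmx k F y)^T = pdmx k F y.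
Proof.
move=> Fsym; rewrite -[LHS](pdmx_tr F).
exact (congr1 (fun h => pdmx k h y) (funext Fsym)).
Qed.

(** * The Levi-Civita connection and its curvature in a chart *)

Section LeviCivitaChart.
Context {R : realType} {n : nat} {M : manifold R n}.
Variables (g : field M n n) (hg : is_metric g) (a : chart_ix M).
Local Notation U := (chart_im a).

Definition gamma k y : 'M[R]_n := koszul (g a y) (fun k => pdmx k (g a) y) k.

Lemma christoffelE y i k j : christoffel g a y i k j = gamma k y i j.
Proof.
rewrite /christoffel /gamma mxE mulr_sumr; apply: eq_bigr => l _.
by rewrite mxE [RHS]mulrCA; congr (_ * (_ * (_ + _ - _))); rewrite pdmxE.
Qed.

Lemma density_formE y k : density_form g a y k = \tr (gamma k y) / n.+1%:R.
Proof. by congr (_ / _); apply: eq_bigr => d _; rewrite christoffelE. Qed.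

Lemma open_chart_im : open U. Proof. exact: chart_im_open. Qed.
Let oU := open_chart_im.

Lemma metric_smooth : smooth_mx_on U (g a). Proof. by case: hg => -[+ _ _] _ _; exact. Qed.

Lemma metric_trmx y : (g a y)^T = g a y. Proof. by case: hg. Qed.

Lemma metric_unitmx y : U y -> g a y \in unitmx. Proof. by case: hg => _ _; exact. Qed.

Lemma pdmx_metric_sym k y : (pdmx k (g a) y)^T = pdmx k (g a) y.
Proof. exact: pdmx_sym metric_trmx. Qed.

Lemma gammaC y k i j : gamma k y i j = gamma j y i k.
Proof. by apply: koszulC => l; exact: pdmx_metric_sym. Qed.

Lemma gamma_compat y k : U y ->
  pdmx k (g a) y = (gamma k y)^T *m g a y + g a y *m gamma k y.
Proof.
move=> Uy; apply: (@koszul_compat _ _ (g a y) (fun k => pdmx k (g a) y)).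
- exact: metric_trmx.
- exact: metric_unitmx.
- by move=> l; exact: pdmx_metric_sym.
Qed.

Lemma lowered_smooth k : smooth_mx_on U (fun y => lowered (fun k => pdmx k (g a) y) k).
Proof.
have s b := smooth_mx_pd b metric_smooth.
move=> i j; under eq_fun do rewrite mxE.
apply: smoothM => //; first exact: smooth_cst.
apply: smoothD => //; first by apply: smoothD => //; exact: s.
by apply: smoothN => //; exact: s.
Qed.

Lemma gamma_smooth k : smooth_mx_on U (gamma k).
Proof.
apply: smooth_mxM => //; last exact: lowered_smooth.
by apply: smooth_invmx => //; [exact: metric_unitmx|exact: metric_smooth].
Qed.

Lemma density_form_smooth k : smooth_on U (fun y => density_form g a y k).
Proof.
have -> : (fun y => density_form g a y k) = (fun y => (\sum_d gamma k y d d) * n.+1%:R^-1).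
  by apply/funext => y; rewrite density_formE.
apply: smoothM => //; last exact: smooth_cst.
by apply: smooth_sum => // d; exact: gamma_smooth.
Qed.

(** Differentiating g Gamma_k = [lowered], rather than Gamma_k itself, avoids the derivative of the
    inverse metric. The result is the hypothesis [dCE] of the curvature algebra. *)
Lemma pd_gamma y l k : U y ->
  pdmx l (g a) y *m gamma k y + g a y *m pdmx l (gamma k) y =
  lowered (fun k => pdmx l (pdmx k (g a)) y) k.
Proof.
move=> Uy.
have dg := smooth_mx_differentiable metric_smooth Uy.
have dC := smooth_mx_differentiable (gamma_smooth k) Uy.
rewrite -(pdmxM _ dg dC).
rewrite (@eq_on_pdmx _ _ _ _ U _ (fun y => lowered (fun k => pdmx k (g a) y) k))//; last first.
  by move=> z; rewrite inE => Uz; rewrite mul_koszul//; exact: metric_unitmx.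
have d b i j : differentiable (fun z => pdmx b (g a) z i j) y.
  exact: smooth_mx_differentiable (smooth_mx_pd b metric_smooth) Uy i j.
apply/matrixP => i j.
have E b i' j' : pdmx l (pdmx b (g a)) y i' j' = pd l (fun z => pdmx b (g a) z i' j') y.
  exact: pdmxE.
have F z : lowered (fun k => pdmx k (g a) z) k i j =
    2^-1 * (pdmx k (g a) z i j + pdmx j (g a) z k i - pdmx i (g a) z k j) by exact: mxE.
have F' : lowered (fun k => pdmx l (pdmx k (g a)) y) k i j = 2^-1 *
    (pd l (fun z => pdmx k (g a) z i j) y + pd l (fun z => pdmx j (g a) z k i) y
     - pd l (fun z => pdmx i (g a) z k j) y).
  by rewrite -(E k i j) -(E j k i) -(E i k j); exact: mxE.
apply: etrans (pdmxE _ _ _ _ _) (etrans _ (esym F')).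
apply: etrans (congr1 (fun h => pd l h y) (funext F)) _.
exact (pd_koszul_term l (d k i j) (d j k i) (d i k j)).
Qed.

Definition curvature l k y : 'M[R]_n :=
  curv (fun k => gamma k y) (fun l k => pdmx l (gamma k) y) l k.

Lemma riemannE y j i l k : riemann g a y j i l k = curvature l k y j i.
Proof.
have e b c i' j' : pdmx b (gamma c) y i' j' = pd b (fun z => christoffel g a z i' c j') y.
  rewrite pdmxE; apply: (congr1 (fun h => pd b h y)); apply/funext => z.
  by rewrite christoffelE.
rewrite /curvature /curv !(addmxE, oppmxE) !e /riemann -addrA; congr (_ + _).
rewrite mxE [X in _ = _ - X]mxE -sumrB; apply: eq_bigr => m _.
by rewrite !christoffelE.
Qed.

Lemma curvature_pair y l k j i : U y ->
  (g a y *m curvature l k y) j i = (g a y *m curvature j i y) l k.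
Proof.
move=> Uy.
apply: (@curv_pair _ _ (g a y) (fun k => pdmx k (g a) y) (fun k => gamma k y)
  (fun l k => pdmx l (pdmx k (g a)) y) (fun l k => pdmx l (gamma k) y)).
- exact: metric_trmx.
- by move=> b c; exact: pdmx_sym (pdmx_metric_sym c).
- by move=> b c; exact: pdmxC oU metric_smooth Uy.
- by move=> *; exact: gammaC.
- by move=> b; exact: gamma_compat.
- by move=> b c; exact: pd_gamma.
Qed.

(** The exterior derivative of [density_form] is a multiple of the trace of the curvature, since the
    commutator of the Christoffel matrices is trace-free. *)
Lemma density_form_closed y l k : U y ->
  pd l (fun z => density_form g a z k) y = pd k (fun z => density_form g a z l) y.
Proof.
move=> Uy.
have dC b := smooth_mx_differentiable (gamma_smooth b) Uy.
have E b c : pd b (fun z => density_form g a z c) y = \tr (pdmx b (gamma c) y) / n.+1%:R.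
  under [in LHS]eq_fun do rewrite density_formE.
  rewrite pdM; [| |exact: differentiable_cst].
    by rewrite pd_cst mulr0 addr0 pd_mxtrace.
  by apply: differentiable_bigsum => d; exact: dC.
rewrite (E l k) (E k l); apply: (congr1 (fun t => t / _)).
have : \tr (curvature l k y) = 0.
  apply: (@mxtrace_curv _ _ (g a y) (fun k => pdmx k (g a) y) (fun k => gamma k y)
    (fun l k => pdmx l (pdmx k (g a)) y) (fun l k => pdmx l (gamma k) y)).
  - exact: metric_trmx.
  - exact: metric_unitmx.
  - by move=> b c; exact: pdmx_sym (pdmx_metric_sym c).
  - by move=> b c; exact: pdmxC oU metric_smooth Uy.
  - by move=> *; exact: gammaC.
  - by move=> b; exact: gamma_compat.
  - by move=> b c; exact: pd_gamma.
rewrite /curvature /curv.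
move: (pdmx l (gamma k) y) (pdmx k (gamma l) y) (gamma l y) (gamma k y) => A A' C C'.
by rewrite -addrA mxtraceD !raddfB/= (mxtrace_mulC C) subrr addr0 => /subr0_eq.
Qed.

Variable w : R.
Definition weight_form k y : R := w * density_form g a y k.

Lemma weight_form_smooth k : smooth_on U (weight_form k).
Proof.
by apply: smoothM => //; [exact: smooth_cst|exact: density_form_smooth].
Qed.

Lemma weight_form_closed y : U y -> forall l k,
  pd l (weight_form k) y = pd k (weight_form l) y.
Proof.
move=> Uy l k; have d b := smooth_differentiable (density_form_smooth b) Uy.
have dw := differentiable_cst w y.
rewrite /weight_form (pdM _ dw (d k)) (pdM _ dw (d l)) !pd_cst !mul0r.
by rewrite density_form_closed.
Qed.

Lemma nabla_TME mu y k b : nabla_TM g a w mu y k b = covTM gamma weight_form k mu y b 0.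
Proof.
rewrite /nabla_TM /nabla_density /covTM !addmxE scalemxE pdmxE; congr (_ + _).
by rewrite mxE; apply: eq_bigr => d _; rewrite christoffelE.
Qed.

Lemma nabla_S2TME s y k b c :
  nabla_S2TM g a w s y k b c = covS gamma weight_form k s y b c.
Proof.
rewrite /nabla_S2TM /nabla_density /covS !addmxE scalemxE pdmxE -[RHS]addrA; congr (_ + _).
rewrite big_split/= mxE; congr (_ + _).
  by apply: eq_bigr => d _; rewrite christoffelE.
by rewrite mxE; apply: eq_bigr => d _; rewrite mxE christoffelE mulrC.
Qed.

End LeviCivitaChart.

(** * The prolonged system in a chart *)

Section Prolongation.
Context {R : realType} {n : nat} {M : manifold R n}.
Variables (g : field M n n) (a : chart_ix M).
Local Notation U := (chart_im a).
Local Notation e_ k := (delta_mx k 0 : 'cV[R]_n).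
Variable w : R.

(* The values that the traces of the first two tractor equations force upon
   [mu] and [rho]. *)
Definition div_mu (s : 'rV[R]_n -> 'M[R]_n) y : 'cV[R]_n :=
  \col_c (- (n.+1%:R)^-1 * \sum_k nabla_S2TM g a w s y k k c).

Definition div_rho (B : R) (s : 'rV[R]_n -> 'M[R]_n) (mu : 'rV[R]_n -> 'cV[R]_n) y : R :=
  - n%:R^-1 * \sum_k (nabla_TM g a w mu y k k - B * \sum_c g a y k c * s y k c).

Lemma outer_deltaE k (u : 'cV[R]_n) b c :
  (e_ k *m u^T + u *m (e_ k)^T) b c = (k == b)%:R * u c 0 + (k == c)%:R * u b 0.
Proof.
by rewrite addmxE !outermxE !mxE eqxx !andbT mulrC [X in X + _]mulrC
  ![_ == k]eq_sym [X in _ + X]mulrC.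
Qed.

(** Origin of the factor 1/(n+1) in [trace_free] and [div_mu]: one trace of the symmetrised delta
    gives n, the other gives 1. *)
Lemma sum_delta_outer (u : 'cV[R]_n) c :
  \sum_k ((k == k)%:R * u c 0 + (k == c)%:R * u k 0) = n.+1%:R * u c 0.
Proof.
rewrite big_split/=; under eq_bigr do rewrite eqxx mul1r.
rewrite sumr_const card_ord; under eq_bigr do rewrite mulrC.
by rewrite sum_dirac -[in RHS]natr1 -[X in X + _]mulr_natl; ring.
Qed.

Lemma div_mu_unique s (mu : 'cV[R]_n) y :
  (forall k b c, nabla_S2TM g a w s y k b c
     + (k == b)%:R * mu c 0 + (k == c)%:R * mu b 0 = 0) -> div_mu s y = mu.
Proof.
move=> H; apply/matrixP => c j; rewrite (ord1 j) mxE.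
have -> : \sum_k nabla_S2TM g a w s y k k c = - (n.+1%:R * mu c 0).
  rewrite -sum_delta_outer -sumrN; apply: eq_bigr => k _.
  by apply/eqP; rewrite -addr_eq0 addrA H.
by rewrite mulNr mulrN opprK mulKf// pnatr_eq0.
Qed.

(** The trace that [trace_free] subtracts is built into [div_mu] with the opposite sign, so the two
    left-hand sides agree identically. *)
Lemma metrisability_covS s y :
  (forall k b c, trace_free (nabla_S2TM g a w s y) k b c = 0) <->
  (forall k b c, nabla_S2TM g a w s y k b c
     + (k == b)%:R * div_mu s y c 0 + (k == c)%:R * div_mu s y b 0 = 0).
Proof.
have E k b c : trace_free (nabla_S2TM g a w s y) k b c = nabla_S2TM g a w s y k b c
     + (k == b)%:R * div_mu s y c 0 + (k == c)%:R * div_mu s y b 0.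
  by rewrite /trace_free !mxE; ring.
by split=> H k b c; [rewrite -E|rewrite E]; exact: H.
Qed.

Lemma div_rho_unique (hn : (0 < n)%N) (B : R) (s : 'rV[R]_n -> 'M[R]_n) mu (rho : R) y :
  (forall k b, nabla_TM g a w mu y k b + (k == b)%:R * rho
     - B * (\sum_c g a y k c * s y b c) = 0) -> div_rho B s mu y = rho.
Proof.
move=> H; rewrite /div_rho.
have -> : \sum_k (nabla_TM g a w mu y k k - B * \sum_c g a y k c * s y k c) =
    - (n%:R * rho).
  have -> : n%:R * rho = \sum_(k < n) rho by rewrite sumr_const card_ord mulr_natl.
  rewrite -sumrN; apply: eq_bigr => k _.
  by have := H k k; rewrite eqxx mul1r => e; lra.
by rewrite mulNr mulrN opprK mulKf// pnatr_eq0 -lt0n.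
Qed.

Hypothesis hg : is_metric g.
Let oU := @open_chart_im _ _ _ a.

Lemma div_mu_smooth s : smooth_mx_on U s -> smooth_mx_on U (div_mu s).
Proof.
move=> ss c j; under eq_fun do rewrite mxE.
apply: smoothM => //; first exact: smooth_cst.
apply: smooth_sum => // k; under eq_fun do rewrite nabla_S2TME.
apply: smooth_covS => //; first exact: (gamma_smooth hg).
exact: (weight_form_smooth hg).
Qed.

Lemma div_rho_smooth B s mu : smooth_mx_on U s -> smooth_mx_on U mu ->
  smooth_on U (div_rho B s mu).
Proof.
move=> ss smu; apply: smoothM => //; first exact: smooth_cst.
apply: smooth_sum => // k; apply: smoothD => //.
  under eq_fun do rewrite nabla_TME.
  apply: smooth_covTM => //; first exact: (gamma_smooth hg).
  exact: (weight_form_smooth hg).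
apply: smoothN => //; apply: smoothM => //; first exact: smooth_cst.
apply: smooth_sum => // c; apply: smoothM; [exact: oU|exact: (metric_smooth hg)|exact: ss].
Qed.

Hypothesis hn : (2 <= n)%N.
Variable B : R.
Hypothesis nullity : forall y, U y -> exists2 v : 'cV[R]_n, v != 0 & in_nullity g a y v.
Hypothesis BE : forall y, U y -> forall v : 'cV[R]_n, in_nullity g a y v ->
  forall i, \sum_j schouten_up g a y i j * v j 0 = B * v i 0.

(** Passage from the component definitions of Weyl nullity and B to the matrix hypothesis [Rv] of
    the contraction lemmas. *)
Lemma nullity_contraction y : U y -> exists2 v : 'cV[R]_n, v != 0 &
  forall l, \sum_k v k 0 *: curvature g a l k y =
    B *: (e_ l *m (v^T *m g a y) - v *m ((e_ l)^T *m g a y)).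
Proof.
move=> Uy; have [v v0 Wv] := nullity Uy; exists v => // l.
pose P : 'M[R]_n := \matrix_(j, k) schouten g a y j k.
have PE j k : P j k = (\sum_i curvature g a i k y i j) / (n%:R - 1).
  by rewrite mxE; congr (_ / _); apply: eq_bigr => i _; rewrite riemannE.
apply: (@contracted_curv _ _ (g a y) (fun l k => curvature g a l k y) P) => //.
- exact (metric_trmx hg a y).
- exact: (metric_unitmx hg).
- by move=> *; exact: (curvature_pair hg).
- move=> i k m; apply: etrans (Wv i k m); apply: eq_bigr => j _.
  by rewrite /weyl riemannE !mxE.
- move=> i; apply: etrans (BE Uy Wv i); apply: eq_bigr => j _; congr (_ * _).
  by apply: eq_bigr => k _; rewrite mxE.
Qed.

Lemma metric_mulE y (s : 'M[R]_n) k b :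
  (s *m (g a y *m e_ k)) b 0 = \sum_c g a y k c * s b c.
Proof.
rewrite mxE; apply: eq_bigr => c _; rewrite mulrC; congr (_ * _).
by rewrite -colE mxE (sym_mxE _ _ (metric_trmx hg a y)).
Qed.

Lemma metric_mul_row y (u : 'cV[R]_n) k :
  ((e_ k)^T *m g a y *m u) 0 0 = \sum_b g a y k b * u b 0.
Proof.
rewrite mxE; apply: eq_bigr => b _; congr (_ * _).
by rewrite trmx_delta -rowE mxE.
Qed.

Variable s : 'rV[R]_n -> 'M[R]_n.
Hypotheses (ss : smooth_mx_on U s) (ssym : forall y, U y -> (s y)^T = s y).
Hypothesis trs : forall y, U y ->
  forall k b c, trace_free (nabla_S2TM g a w s y) k b c = 0.

Local Notation mu := (div_mu s).
Local Notation rho := (div_rho B s mu).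
Local Notation C := (gamma g a).
Local Notation cw := (weight_form g a w).

Lemma covS_solution y : U y -> forall k,
  covS C cw k s y = - (e_ k *m (mu y)^T + mu y *m (e_ k)^T).
Proof.
move=> Uy k; apply/matrixP => b c; rewrite oppmxE outer_deltaE -nabla_S2TME.
by apply/eqP; rewrite -addr_eq0 addrA; apply/eqP; exact: ((metrisability_covS s y).1 (trs Uy)).
Qed.

Lemma nabla_mu y : U y -> forall k b,
  nabla_TM g a w mu y k b + (k == b)%:R * rho y - B * (\sum_c g a y k c * s y b c) = 0.
Proof.
move=> Uy.
have [v v0 Rv] := nullity_contraction Uy.
have gs := gamma_smooth hg (a := a).
have cs := weight_form_smooth hg (a := a) w.
have cc y (Uy : U y) := weight_form_closed hg w Uy.
have gC y (Uy : U y) := gammaC hg a y.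
have RS := metrisability_integrability oU gs gC cs cc ss (div_mu_smooth ss) covS_solution Uy.
have [r Nr] := metrisability_contraction hn (metric_trmx hg a y) v0 Rv (ssym Uy) RS.
(* The contraction yields nabla_k mu = r e_k + B s g e_k, so -r is the required scalar. As [r] comes
   from an existential at the single point [y], it is then identified with the explicit [div_rho],
   which is smooth and can be differentiated next. *)
have H k b : nabla_TM g a w mu y k b + (k == b)%:R * (- r)
    - B * (\sum_c g a y k c * s y b c) = 0.
  rewrite nabla_TME Nr addmxE !scalemxE metric_mulE mxE eqxx andbT eq_sym; ring.
by move=> k b; rewrite (div_rho_unique (ltnW hn) H).
Qed.

Lemma nabla_rho y : U y -> forall k,
  nabla_density g a w rho y k - 2 * B * (\sum_b g a y k b * mu y b 0) = 0.
Proof.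
move=> Uy.
have [v v0 Rv] := nullity_contraction Uy.
have gs := gamma_smooth hg (a := a).
have cs := weight_form_smooth hg (a := a) w.
have cc y (Uy : U y) := weight_form_closed hg w Uy.
have gC y (Uy : U y) := gammaC hg a y.
have gsym y (Uy : U y) := metric_trmx hg a y.
have gcomp y (Uy : U y) k := gamma_compat hg k Uy.
have eqmu z : U z -> forall k,
    covTM C cw k mu z = - rho z *: e_ k + B *: (s z *m (g a z *m e_ k)).
  move=> Uz k; apply/matrixP => b j; rewrite (ord1 j) -nabla_TME.
  rewrite addmxE !scalemxE metric_mulE mxE eqxx andbT eq_sym.
  by have := nabla_mu Uz k b; lra.
have smu := div_mu_smooth ss; have srho := div_rho_smooth B ss smu.
have RS := divergence_integrability oU gs gC cs cc (metric_smooth hg (a := a)) gsym gcomp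
  ss smu srho ssym covS_solution eqmu Uy.
have T := divergence_contraction hn v0 Rv RS.
move=> k; have /= := T k; rewrite metric_mul_row /nabla_density -/(weight_form _ _ _ _ _).
move=> e; apply/eqP; rewrite subr_eq0; apply/eqP.
(* One multiple of B g mu is already subtracted in the [t] of [divergence_integrability], and
   [divergence_contraction] contributes the other; hence the coefficient 2 B. *)
by rewrite -mulrA [RHS]mulr_natl mulr2n -{1}e; ring.
Qed.

End Prolongation.

(** * Change of charts *)

Lemma pd_coord (R : realType) (n : nat) (i j : 'I_n) (y : 'rV[R]_n) :
  pd j (fun z : 'rV[R]_n => z 0 i) y = (i == j)%:R.
Proof.
have d : derivable (id : 'rV[R]_n -> 'rV[R]_n) y (delta_mx 0 j) by exact: derivable_id.
have /matrixP/(_ 0 i) := etrans (esym (derive_id y (delta_mx 0 j))) (derive_mx d).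
by rewrite !mxE eqxx/= => ->.
Qed.

(** Writing |d|^p as (d^2)^(p/2) removes the absolute value, so the sign of [d] need not be
    distinguished. *)
Lemma norm_powR_pd (R : realType) (n : nat) (d : 'rV[R]_n -> R) (p : R) y :
  differentiable d y -> d y != 0 ->
  differentiable (fun z => `|d z| `^ p) y /\
  forall k, pd k (fun z => `|d z| `^ p) y = p * `|d y| `^ p * (pd k d y / d y).
Proof.
move=> dd d0.
have e x : `|x| `^ p = (x * x) `^ (p / 2) :> R.
  by rewrite -expr2 -real_normK ?num_real// -powR_mulrn// -powRrM mulrCA divff ?mulr1.
have -> : (fun z => `|d z| `^ p) = (fun x : R => x `^ (p / 2)) \o (fun z => d z * d z).
  by apply/funext => z; exact: e.
have dp : 0 < d y * d y by rewrite lt0r mulf_neq0// -expr2 sqr_ge0.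
have D := @is_derive1_powR R (p / 2) _ dp.
have D1 : differentiable (fun x : R => x `^ (p / 2)) (d y * d y).
  by apply/derivable1_diffP; case: D.
have Dv : 'd (fun x : R => x `^ (p / 2)) (d y * d y) 1 =
    p / 2 * (d y * d y) `^ (p / 2 - 1) by rewrite -deriveE//; case: D.
have D2 : differentiable (fun z => d z * d z) y by exact: differentiableM.
split; first exact: (differentiable_comp D2 D1).
move=> k; rewrite /pd deriveE; last exact: (differentiable_comp D2 D1).
rewrite (diff_comp D2 D1)/= -[X in 'd _ _ X]mulr1 linearZ/= Dv.
have -> : (d y * d y) `^ (p / 2 - 1) = (d y * d y) `^ (p / 2) / (d y * d y).
  by rewrite powRB ?(gt_eqF dp) ?implybT// powRr1// ltW.
rewrite -deriveE// -/(pd k _ y) pdM// e -/(pd k d y) -[LHS]/(_ * _).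
move: (pd k d y) (_ `^ (p / 2)) => x z.
by field.
Qed.

Section Transition.
Context {R : realType} {n : nat} {M : manifold R n}.
Variables (a b : chart_ix M).
Local Notation V := (overlap a b).
Local Notation tau := (transition a b).
Local Notation J := (trans_jac a b).

Lemma overlap_chart_im y : V y -> chart_im a y.
Proof. by move=> [x [ax bx] <-]; exists x. Qed.

Lemma transition_overlap y : V y -> overlap b a (tau y).
Proof.
move=> [x [ax bx] <-]; exists x; first by split.
by rewrite /transition/= chart_mapK.
Qed.

Lemma transitionK y : V y -> transition b a (tau y) = y.
Proof. by move=> [x [ax bx] <-]; rewrite /transition/= !chart_mapK. Qed.

Lemma overlap_open : open V.
Proof.
have -> : V = chart_im a `&` chart_inv a @^-1` chart_dom b.
  apply/seteqP; split=> y.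
    move=> [x [ax bx] <-]; split; first by exists x.
    by rewrite /preimage/= chart_mapK.
  by move=> [[x ax <-]]; rewrite /preimage/= chart_mapK// => bx; exists x.
(* [chart_inv a] is known to be continuous only at points of the chart image, so openness is checked
   point by point. *)
rewrite openE => y [ay by_].
have oa : open (chart_im a) by exact: chart_im_open.
rewrite /interior; apply: filterI; first exact: open_nbhs_nbhs.
apply: (chart_inv_continuous ay); apply: open_nbhs_nbhs; split=> //.
exact: chart_dom_open.
Qed.

Lemma transition_smooth : smooth_mx_on V tau.
Proof. exact: chart_compatible. Qed.

Lemma transition_differentiable y : V y -> mx_differentiable tau y.
Proof. exact: smooth_mx_differentiable transition_smooth. Qed.

Lemma trans_jacE y i j : J y i j = pd j (fun z => tau z 0 i) y.
Proof. by rewrite mxE. Qed.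

Lemma trans_jac_smooth : smooth_mx_on V J.
Proof.
move=> i j; have -> : (fun y => J y i j) = pd j (fun z => tau z 0 i).
  by apply/funext => y; exact: trans_jacE.
exact: smooth_pd (transition_smooth 0 i).
Qed.

Lemma pd_trans_jacC y k i j : V y -> pdmx k J y i j = pdmx j J y i k.
Proof.
move=> Vy.
have e b' c : pdmx b' J y i c = pd b' (pd c (fun z => tau z 0 i)) y.
  rewrite pdmxE; apply: (congr1 (fun h => pd b' h y)).
  by apply/funext => z; exact: trans_jacE.
apply: etrans (e k j) (etrans _ (esym (e j k))).
exact (pdC k j overlap_open (transition_smooth 0 i) Vy).
Qed.

End Transition.

Section TransitionInverse.
Context {R : realType} {n : nat} {M : manifold R n}.
Variables (a b : chart_ix M).
Local Notation V := (overlap a b).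
Local Notation tau := (transition a b).
Local Notation J := (trans_jac a b).

Lemma trans_jac_mul y : V y -> trans_jac b a (tau y) *m J y = 1%:M.
Proof.
move=> Vy; apply/matrixP => i j.
have dtau := transition_differentiable Vy.
have dtau' := transition_differentiable (transition_overlap Vy).
have e : pd j ((fun z => transition b a z 0 i) \o tau) y = (i == j)%:R.
  rewrite -(pd_coord i j y).
  apply: (eq_on_pd _ (@overlap_open _ _ _ a b) Vy) => z; rewrite inE => Vz /=.
  by rewrite transitionK.
rewrite [RHS]mxE -e (pd_comp _ (dtau 0) (dtau' 0 i)) mxE; apply: eq_bigr => l _.
by rewrite !trans_jacE.
Qed.

Lemma trans_jac_unit y : V y -> J y \in unitmx.
Proof. by move=> /trans_jac_mul/mulmx1_unit[]. Qed.

Lemma det_trans_jac_neq0 y : V y -> \det (J y) != 0.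
Proof. by move=> /trans_jac_unit; rewrite unitmxE unitfE. Qed.

Lemma density_factorD v w y : V y ->
  density_factor v a b y * density_factor w a b y = density_factor (v + w) a b y.
Proof.
move=> Vy; rewrite /density_factor mulrDl powRD//.
by rewrite normr_eq0 det_trans_jac_neq0 ?implybT.
Qed.

Lemma density_factor0 y : density_factor 0 a b y = 1.
Proof. by rewrite /density_factor mul0r powRr0. Qed.

Lemma det_trans_jac_differentiable y : V y ->
  differentiable (fun z => \det (J z)) y.
Proof.
have sd := smooth_det (@overlap_open _ _ _ a b) (@trans_jac_smooth _ _ _ a b).
exact: smooth_differentiable sd.
Qed.

Lemma density_factor_differentiable w y : V y ->
  differentiable (density_factor w a b) y.
Proof.
move=> Vy; have dd := det_trans_jac_differentiable Vy.
exact: (norm_powR_pd (w / n.+1%:R) dd (det_trans_jac_neq0 Vy)).1.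
Qed.

Lemma pd_det_trans_jac k y : V y ->
  pd k (fun z => \det (J z)) y / \det (J y) = \tr (invmx (J y) *m pdmx k J y).
Proof.
move=> Vy; rewrite pd_det_Jacobi; last first.
  exact: smooth_mx_differentiable (@trans_jac_smooth _ _ _ a b) Vy.
rewrite /invmx trans_jac_unit// -scalemxAl mxtraceZ mulrC.
by [].
Qed.

Variables (g : field M n n) (hg : is_metric g).

Lemma metric_transition y : V y -> g a y = (J y)^T *m g b (tau y) *m J y.
Proof. by case: hg => -[_ _ +] _ _ => /(_ a b y). Qed.

(** The matrices [C k] that solve this law for the symbols in chart [a] are symmetric because second
    derivatives of the transition commute, and compatible with g by differentiating g_a = J^T g_b J.
    Hence they are the Christoffel matrices by [koszul_uniq]. *)
Lemma gamma_transition k y : V y ->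
  J y *m gamma g a k y = pdmx k J y + \sum_l J y l k *: (gamma g b l (tau y) *m J y).
Proof.
move=> Vy; pose C k := invmx (J y) *m (pdmx k J y + \sum_l J y l k *: (gamma g b l (tau y) *m J y)).
have uJ := trans_jac_unit Vy.
have bV := overlap_chart_im (transition_overlap Vy).
have dtau := transition_differentiable Vy.
have dJ := smooth_mx_differentiable (@trans_jac_smooth _ _ _ a b) Vy.
have dJT := mx_differentiable_tr dJ.
have dgb := smooth_mx_differentiable (metric_smooth hg (a := b)) bV.
have dgt : mx_differentiable (g b \o tau) y.
  by move=> i j; apply: (differentiable_comp_row (dtau 0) (dgb i j)).
suff <- : C k = gamma g a k y by rewrite mulKVmx.
apply: (@koszul_uniq _ _ (g a y) (fun k => pdmx k (g a) y)).
- exact: metric_trmx.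
- exact: metric_unitmx (overlap_chart_im Vy).
- move=> k' i j; rewrite !mxE; apply: eq_bigr => m _; congr (_ * _).
  rewrite !addmxE; apply: (congr2 +%R); first exact: pd_trans_jacC.
  rewrite !summxE.
  have e l c : (gamma g b l (tau y) *m J y) m c = \sum_q gamma g b l (tau y) m q * J y q c.
    by rewrite mxE.
  under eq_bigr do rewrite scalemxE e mulr_sumr.
  under [RHS]eq_bigr do rewrite scalemxE e mulr_sumr.
  rewrite exchange_big; apply: eq_bigr => q _; apply: eq_bigr => l _.
  rewrite mulrCA [RHS]mulrCA (gammaC hg b (tau y) l).
  by apply: (congr1 ( *%R _)); exact: mulrC.
move=> k'.
rewrite (@eq_on_pdmx _ _ _ _ V _ (fun z => (J z)^T *m (g b \o tau) z *m J z)) //; last first.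
- by move=> z; rewrite inE => Vz; exact: metric_transition.
- exact: overlap_open.
rewrite (pdmxM _ (mx_differentiable_mul dJT dgt) dJ) (pdmxM _ dJT dgt) pdmx_tr.
rewrite (pdmx_comp _ dtau dgb) -/(trans_jac a b y).
pose C' := \sum_l J y l k' *: gamma g b l (tau y).
have -> : \sum_l J y l k' *: pdmx l (g b) (tau y) =
    C'^T *m g b (tau y) + g b (tau y) *m C'.
  rewrite raddf_sum/= mulmx_suml mulmx_sumr -big_split/=; apply: eq_bigr => l _.
  by rewrite (gamma_compat hg)// trmx_scaleE -scalemxAl -scalemxAr -scalerDr.
have CE : J y *m C k' = pdmx k' J y + C' *m J y.
  rewrite mulKVmx// mulmx_suml; congr (_ + _); apply: eq_bigr => l _.
  by rewrite scalemxAl.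
rewrite (metric_transition Vy) -!mulmxA CE !mulmxA -trmx_mul CE /=.
move: (pdmx k' J y) (J y) (g b (tau y)) => dJ' Jy gb.
rewrite !(trmx_addE, trmx_mul, mulmxDl, mulmxDr, mulmxA).
by apply/matrixP => i j; rewrite !addmxE; ring.
Qed.

Lemma density_form_transition k y : V y ->
  density_form g a y k - \sum_l J y l k * density_form g b (tau y) l =
  \tr (invmx (J y) *m pdmx k J y) / n.+1%:R.
Proof.
move=> Vy; have uJ := trans_jac_unit Vy.
rewrite density_formE -(mulKmx uJ (gamma g a k y)) gamma_transition// mulmxDr mxtraceD.
rewrite mulrDl -addrA; apply/eqP; rewrite eq_sym -subr_eq0 opprD addrA subrr add0r oppr_eq0.
apply/eqP; rewrite mulmx_sumr raddf_sum/= mulr_suml -sumrB big1// => l _.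
rewrite -scalemxAr linearZ/= mxtrace_mulC -mulmxA mulmxV// mulmx1 density_formE.
by rewrite mulrA subrr.
Qed.

(** By Jacobi's formula the logarithmic derivative of det J is tr(J^-1 dJ), which is also the
    inhomogeneous term in the trace of [gamma_transition]. This is the covariance of the connection
    on E(w). *)
Lemma pd_density_factor w k y : V y ->
  pd k (density_factor w a b) y = w * density_factor w a b y *
    (density_form g a y k - \sum_l J y l k * density_form g b (tau y) l).
Proof.
move=> Vy; rewrite density_form_transition// -pd_det_trans_jac//.
have dd := det_trans_jac_differentiable Vy.
rewrite [LHS](norm_powR_pd (w / n.+1%:R) dd (det_trans_jac_neq0 Vy)).2.
rewrite -/(density_factor w a b y).
by move: (_ / \det _) (density_factor w a b y) => X L; ring.
Qed.

End TransitionInverse.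

(** The lower index transforms with J^-1 and the row index with J, so contracting them leaves only
    [A], the law of the remaining index together with the weight. *)
Lemma contraction_transition (R : fieldType) (n p q : nat) (J : 'M[R]_n)
    (Tb : 'I_n -> 'M[R]_(n, q)) (Ta : 'I_n -> 'M[R]_(n, p)) (A : 'M[R]_(p, q)) :
  J \in unitmx -> (forall k, \sum_l J l k *: Tb l = J *m Ta k *m A) ->
  \sum_l row l (Tb l) = (\sum_k row k (Ta k)) *m A.
Proof.
move=> uJ H.
have -> : (\sum_k row k (Ta k)) *m A = \sum_k row k (invmx J *m \sum_l J l k *: Tb l).
  rewrite mulmx_suml; apply: eq_bigr => k _.
  by rewrite H -mulmxA mulKmx// row_mul.
apply/matrixP => i c; rewrite !summxE.
transitivity (\sum_l \sum_p (\sum_k J l k * invmx J k p) * Tb l p c).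
  have JJ l p' : \sum_k J l k * invmx J k p' = (l == p')%:R.
    by transitivity ((J *m invmx J) l p'); [rewrite mxE|rewrite mulmxV// mxE].
  apply: eq_bigr => l _; under eq_bigr do rewrite JJ.
  rewrite mxE (bigD1 l)//= eqxx mul1r big1 ?addr0// => p' pl.
  by rewrite eq_sym (negPf pl) mul0r.
under eq_bigr do under eq_bigr do rewrite mulr_suml.
rewrite pair_big exchange_big/=; apply: eq_bigr => k _.
rewrite mxE [RHS]mxE -(pair_big xpredT xpredT (fun l p' => J l k * invmx J k p' * Tb l p' c))/=.
rewrite exchange_big/=; apply: eq_bigr => p' _.
rewrite summxE mulr_sumr; apply: eq_bigr => l _.
by rewrite mxE mulrCA mulrA.
Qed.

(** * Covariance of the derivatives and of their contractions *)

Section TransitionDerivatives.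
Context {R : realType} {n : nat} {M : manifold R n}.
Variables (g : field M n n) (hg : is_metric g) (a b : chart_ix M) (w : R).
Local Notation V := (overlap a b).
Local Notation tau := (transition a b).
Local Notation J := (trans_jac a b).
Local Notation lam := (density_factor w a b).
Variable y : 'rV[R]_n.
Hypothesis Vy : V y.

Let oV := @overlap_open _ _ _ a b.
Let dtau := transition_differentiable Vy.
Let dJ := smooth_mx_differentiable (@trans_jac_smooth _ _ _ a b) Vy.
Let dlam := density_factor_differentiable w Vy.

Lemma sum_gamma_mul k (q : nat) (A : 'M[R]_(n, q)) :
  \sum_l J y l k *: (gamma g b l (tau y) *m A) = (\sum_l J y l k *: gamma g b l (tau y)) *m A.
Proof. by rewrite mulmx_suml; apply: eq_bigr => l _; rewrite scalemxAl. Qed.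

Lemma sum_weight (p q : nat) k (A : 'M[R]_(p, q)) :
  \sum_l J y l k *: (weight_form g b w l (tau y) *: A) =
  (w * \sum_l J y l k * density_form g b (tau y) l) *: A.
Proof.
rewrite mulr_sumr scaler_suml; apply: eq_bigr => l _.
by rewrite scalerA mulrCA.
Qed.

(** The derivatives of J and of the density factor created by the product rule cancel against the
    inhomogeneous terms of [gamma_transition] and [pd_density_factor]. *)
Lemma covTM_transition k (ma mb : 'rV[R]_n -> 'cV[R]_n) :
  mx_differentiable ma y -> mx_differentiable mb (tau y) ->
  (forall z, V z -> mb (tau z) = lam z *: (J z *m ma z)) ->
  \sum_l J y l k *: covTM (gamma g b) (weight_form g b w) l mb (tau y) =
  J y *m covTM (gamma g a) (weight_form g a w) k ma y *m (lam y)%:M.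
Proof.
move=> dma dmb E.
have Ek : \sum_l J y l k *: pdmx l mb (tau y) =
    pd k lam y *: (J y *m ma y) + lam y *: (pdmx k J y *m ma y + J y *m pdmx k ma y).
  rewrite -(pdmxM _ dJ dma) -(pdmx_scale _ dlam (mx_differentiable_mul dJ dma)).
  rewrite -(pdmx_comp _ dtau dmb); apply: eq_on_pdmx oV Vy _ => z; rewrite inE; exact: E.
under eq_bigr do rewrite /covTM !scalerDr.
rewrite !big_split/= Ek sum_weight sum_gamma_mul E// (pd_density_factor hg)// mul_mx_scalar.
rewrite /covTM !mulmxDr mulmxA (gamma_transition hg)// sum_gamma_mul.
rewrite -scalemxAr /weight_form.
move: (\sum_l J y l k * _) (\sum_l J y l k *: _) => W C'.
move: (density_form g a y k) (lam y) (pdmx k J y) (pdmx k ma y) (J y) (ma y) => o L dj dm j m.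
rewrite !(mulmxDl, mulmxDr, scalerDr, mulmxA) -?scalemxAr -?scalemxAl.
by apply/matrixP => i c; rewrite !(addmxE, oppmxE, scalemxE, mulmxA); ring.
Qed.

Lemma covS_transition k (sa sb : 'rV[R]_n -> 'M[R]_n) :
  mx_differentiable sa y -> mx_differentiable sb (tau y) ->
  (forall z, V z -> sb (tau z) = lam z *: (J z *m sa z *m (J z)^T)) ->
  \sum_l J y l k *: covS (gamma g b) (weight_form g b w) l sb (tau y) =
  J y *m covS (gamma g a) (weight_form g a w) k sa y *m (lam y *: (J y)^T).
Proof.
move=> dsa dsb E.
have dJT := mx_differentiable_tr dJ.
have dJs := mx_differentiable_mul dJ dsa.
have Ek : \sum_l J y l k *: pdmx l sb (tau y) =
    pd k lam y *: (J y *m sa y *m (J y)^T)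
    + lam y *: ((pdmx k J y *m sa y + J y *m pdmx k sa y) *m (J y)^T
                + J y *m sa y *m (pdmx k J y)^T).
  rewrite -(pdmxM _ dJ dsa) -(pdmx_tr J) -(pdmxM _ dJs dJT).
  rewrite -(pdmx_scale _ dlam (mx_differentiable_mul dJs dJT)).
  rewrite -(pdmx_comp _ dtau dsb); apply: eq_on_pdmx oV Vy _ => z; rewrite inE; exact: E.
have sT (A : 'M[R]_n) : \sum_l J y l k *: (A *m (gamma g b l (tau y))^T) =
    A *m (\sum_l J y l k *: gamma g b l (tau y))^T.
  rewrite raddf_sum/= mulmx_sumr; apply: eq_bigr => l _.
  by rewrite trmx_scaleE scalemxAr.
under eq_bigr do rewrite /covS !scalerDr.
rewrite !big_split/= Ek sum_weight sum_gamma_mul sT E// (pd_density_factor hg)//.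
have JC := gamma_transition hg k Vy; rewrite sum_gamma_mul in JC.
rewrite /covS; move: (gamma g a k y) JC => Ga JC.
rewrite !mulmxDr !mulmxDl !mulmxA JC.
have -> : J y *m sa y *m Ga^T *m (lam y *: (J y)^T) =
    lam y *: (J y *m sa y *m (J y *m Ga)^T).
  by rewrite trmx_mul -scalemxAr !mulmxA.
rewrite JC /weight_form.
move: (\sum_l J y l k * _) (\sum_l J y l k *: _) => W C'.
move: (density_form g a y k) (lam y) (pdmx k J y) (pdmx k sa y) (J y) (sa y) => o L dj dm j m.
rewrite !(trmx_addE, trmx_mul, mulmxDl, mulmxDr, scalerDr, mulmxA) -?scalemxAr -?scalemxAl.
rewrite -?scalemxAr -?scalemxAl !(mulmxDl, mulmxDr, scalerDr, mulmxA) -?scalemxAr -?scalemxAl.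
by apply/matrixP => i c; rewrite !(addmxE, oppmxE, scalemxE, mulmxA); ring.
Qed.

Lemma div_mu_transition (sa sb : 'rV[R]_n -> 'M[R]_n) :
  mx_differentiable sa y -> mx_differentiable sb (tau y) ->
  (forall z, V z -> sb (tau z) = lam z *: (J z *m sa z *m (J z)^T)) ->
  div_mu g b w sb (tau y) = lam y *: (J y *m div_mu g a w sa y).
Proof.
move=> dsa dsb E.
have dE c x (s : 'rV[R]_n -> 'M[R]_n) : div_mu g c w s x = - (n.+1%:R)^-1 *:
   (\sum_k row k (covS (gamma g c) (weight_form g c w) k s x))^T.
  apply/matrixP => i j; rewrite !mxE summxE; congr (_ * _); apply: eq_bigr => k _.
  by rewrite mxE nabla_S2TME.
have C := contraction_transition (trans_jac_unit Vy) (fun k => covS_transition k dsa dsb E).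
rewrite !dE; apply: etrans (congr1 (fun X => - (n.+1%:R)^-1 *: X^T) C) _.
move: (\sum_k row k _) => X.
by rewrite trmx_mul trmx_scaleE trmxK -scalemxAr -scalemxAl !scalerA mulrC.
Qed.

(** The first term of [div_rho] is a contracted covariant derivative. The second is tr(g s), which
    scales by the density factor alone since g_a = J^T g_b J and the trace is cyclic. *)
Lemma div_rho_transition (B : R) (sa sb : 'rV[R]_n -> 'M[R]_n)
    (ma mb : 'rV[R]_n -> 'cV[R]_n) :
  mx_differentiable ma y -> mx_differentiable mb (tau y) ->
  sb (tau y) = lam y *: (J y *m sa y *m (J y)^T) ->
  (forall z, V z -> mb (tau z) = lam z *: (J z *m ma z)) ->
  (sa y)^T = sa y ->
  div_rho g b w B sb mb (tau y) = lam y * div_rho g a w B sa ma y.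
Proof.
move=> dma dmb Es Em ssym.
have uJ := trans_jac_unit Vy.
have dE c x (s : 'rV[R]_n -> 'M[R]_n) (m : 'rV[R]_n -> 'cV[R]_n) : (s x)^T = s x ->
  div_rho g c w B s m x = - n%:R^-1 *
   ((\sum_k row k (covTM (gamma g c) (weight_form g c w) k m x)) 0 0
    - B * \tr (g c x *m s x)).
  move=> sx; rewrite /div_rho sumrB summxE -mulr_sumr; congr (_ * (_ - _ * _)).
    by apply: eq_bigr => k _; rewrite mxE nabla_TME.
  apply: eq_bigr => k _; rewrite mxE; apply: eq_bigr => d _.
  by rewrite (sym_mxE d k sx).
rewrite !dE//; last by rewrite Es trmx_scaleE !trmx_mul trmxK ssym mulmxA.
rewrite (contraction_transition uJ (fun k => covTM_transition k dma dmb Em)).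
rewrite mul_mx_scalar mxE (metric_transition hg Vy) Es -scalemxAr mxtraceZ.
have -> : \tr (g b (tau y) *m (J y *m sa y *m (J y)^T)) =
    \tr ((J y)^T *m g b (tau y) *m J y *m sa y).
  by rewrite [RHS]mxtrace_mulC [in RHS]mxtrace_mulC -!mulmxA mxtrace_mulC !mulmxA.
by ring.
Qed.

End TransitionDerivatives.

(** * Tractors *)

Section TractorSplitting.
Context {R : realType} {n : nat} {M : manifold R n}.
Variables (g : field M n n) (a : chart_ix M).
Local Notation Q := (jet_splitting g a).

(** Inverse of [tractor_split]: the chart components of the tractor whose slots in the splitting of
    g are given. *)
Definition unsplit_mx y (s : 'M[R]_n) (mu : 'cV[R]_n) (rho : R) : 'M[R]_(n + 1) :=
  (Q y)^T *m block_mx s mu mu^T rho%:M *m Q y.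

Lemma jet_splitting_inv y : Q y *m block_mx 1%:M (- \col_k density_form g a y k) 0 1%:M = 1%:M.
Proof.
rewrite mulmx_block !mul1mx !mulmx1 !mulmx0 !mul0mx !addr0 add0r addNr.
by rewrite -scalar_mx_block.
Qed.

Lemma jet_splitting_unit y : Q y \in unitmx.
Proof. by have /mulmx1_unit[] := jet_splitting_inv y. Qed.

Lemma tractor_splitK S y : (Q y)^T *m tractor_split g S a y *m Q y = S a y.
Proof.
rewrite /tractor_split !mulmxA -trmx_mul mulVmx ?jet_splitting_unit// trmx1 mul1mx.
by rewrite mulmxKV// jet_splitting_unit.
Qed.

Lemma tractor_splitE S y s mu rho : S a y = unsplit_mx y s mu rho ->
  tractor_split g S a y = block_mx s mu mu^T rho%:M.
Proof.
move=> e; rewrite /tractor_split e /unsplit_mx !mulmxA -trmx_mul.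
by rewrite mulmxV ?jet_splitting_unit// trmx1 mul1mx mulmxK// jet_splitting_unit.
Qed.

(** The splitting is unipotent and fixes the upper-left block, so sigma is the same for every
    metric: it is the projection of S^2 T onto S^2 TM(-2). *)
Lemma split_sigmaE S y : split_sigma g S a y = ulsubmx (S a y).
Proof.
rewrite -(tractor_splitK S) /split_sigma; move: (tractor_split g S a y) => T.
rewrite -[X in (_ *m X *m _)]submxK.
rewrite /jet_splitting tr_block_mx !mulmx_block block_mxKul.
by rewrite !trmx0 !trmx1 !mul1mx !mulmx1 !mul0mx !mulmx0 !addr0.
Qed.

Lemma tractor_split_sym S y : (S a y)^T = S a y ->
  (tractor_split g S a y)^T = tractor_split g S a y.
Proof. by move=> Ssym; rewrite /tractor_split !trmx_mul trmxK Ssym mulmxA. Qed.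

Lemma unsplitE S y : (S a y)^T = S a y ->
  S a y = unsplit_mx y (split_sigma g S a y) (split_mu g S a y) (split_rho g S a y).
Proof.
move=> /tractor_split_sym tsym; rewrite -[LHS]tractor_splitK /unsplit_mx.
congr (_ *m _ *m _); rewrite -[LHS]submxK; congr block_mx.
  by rewrite /split_mu -[in RHS]tsym trmx_ursub trmxK.
by rewrite [LHS]mx11_scalar.
Qed.

Lemma split_unsplit S y s mu rho : S a y = unsplit_mx y s mu rho ->
  [/\ split_sigma g S a y = s, split_mu g S a y = mu & split_rho g S a y = rho].
Proof.
move=> /tractor_splitE e; rewrite /split_sigma /split_mu /split_rho e.
by rewrite block_mxKul block_mxKur block_mxKdr mxE eqxx mulr1n.
Qed.

Lemma trmx_unsplit y s mu rho : s^T = s ->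
  (unsplit_mx y s mu rho)^T = unsplit_mx y s mu rho.
Proof.
move=> ss; rewrite /unsplit_mx; move: (jet_splitting g a y) => q.
by rewrite !trmx_mul trmxK tr_block_mx ss trmxK tr_scalar_mx mulmxA.
Qed.

Lemma jet_splitting_smooth (hg : is_metric g) : smooth_mx_on (chart_im a) Q.
Proof.
have oU := @open_chart_im _ _ _ a.
apply: smooth_mx_block => //; try exact: smooth_mx_cst.
move=> i j; under eq_fun do rewrite mxE; exact: density_form_smooth.
Qed.

End TractorSplitting.

Section TractorTransition.
Context {R : realType} {n : nat} {M : manifold R n}.
Variables (g : field M n n) (hg : is_metric g) (a b : chart_ix M) (y : 'rV[R]_n).
Hypothesis Vy : overlap a b y.
Local Notation tau := (transition a b).
Local Notation J := (trans_jac a b).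
Local Notation lam := (density_factor 1 a b y).
Local Notation lam2 := (density_factor (-2) a b y).

(** Each of the two tractor slots is dual to jets of weight 1; this relation converts their factors
    into the weight -2 of sigma, mu and rho. *)
Lemma density_factor_sq : lam * lam * lam2 = 1.
Proof.
rewrite !density_factorD// (_ : 1 + 1 + -2 = 0) ?density_factor0//; ring.
Qed.

(** The derivative of the density factor in the jet cocycle is cancelled by the change of
    [density_form], by [pd_density_factor] at weight 1. What remains is block diagonal because
    (nabla f, f) consists of tensors. *)
Lemma jet_splitting_cocycle :
  jet_splitting g b (tau y) *m jet_cocycle a b y =
  block_mx (lam *: (invmx (J y))^T) 0 0 lam%:M *m jet_splitting g a y.
Proof.
rewrite /jet_splitting /jet_cocycle !mulmx_block.
rewrite !mul1mx !mulmx1 !mul0mx !mulmx0 !addr0 !add0r; congr block_mx.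
have uJ := trans_jac_unit Vy.
have -> : \col_k pd k (density_factor 1 a b) y =
    lam *: (\col_k density_form g a y k
            - (J y)^T *m \col_l density_form g b (tau y) l).
  apply/matrixP => k j; rewrite mxE (pd_density_factor hg)// mul1r.
  rewrite scalemxE addmxE oppmxE mxE [X in _ = _ * (_ - X)]mxE.
  by congr (_ * (_ - _)); apply: eq_bigr => l _; rewrite !mxE.
rewrite -scalemxAr mulmxBr mulmxA -trmx_mul mulmxV// trmx1 mul1mx.
by rewrite mul_mx_scalar -scalemxAl scalerBr subrK.
Qed.

Lemma unsplit_transition (s : 'M[R]_n) (mu : 'cV[R]_n) (rho : R) :
  (jet_cocycle a b y)^T *m
    unsplit_mx g b (tau y) (lam2 *: (J y *m s *m (J y)^T)) (lam2 *: (J y *m mu)) (lam2 * rho)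
    *m jet_cocycle a b y = unsplit_mx g a y s mu rho.
Proof.
have uJ := trans_jac_unit Vy.
rewrite /unsplit_mx !mulmxA -trmx_mul -mulmxA -mulmxA jet_splitting_cocycle.
rewrite trmx_mul !mulmxA; congr (_ *m _); rewrite -!mulmxA; congr (_ *m _).
rewrite !mulmxA tr_block_mx !mulmx_block !trmx0 !mul0mx !mulmx0 !addr0 !add0r.
rewrite tr_scalar_mx !trmx_scaleE trmxK !trmx_mul.
have := density_factor_sq; move: lam lam2 => L L2 sq.
congr block_mx.
- rewrite -!scalemxAl -!scalemxAr !mulmxA mulVmx// mul1mx -scalemxAl -mulmxA -trmx_mul.
  by rewrite mulVmx// trmx1 mulmx1 !scalerA -[RHS]scale1r -sq; congr (_ *: _); ring.
- rewrite mul_mx_scalar -!scalemxAl -!scalemxAr mulKmx// !scalerA -[RHS]scale1r -sq.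
  by congr (_ *: _); ring.
- rewrite mul_scalar_mx -!scalemxAl -!scalemxAr -mulmxA -trmx_mul mulVmx// trmx1 mulmx1.
  by rewrite !scalerA -[RHS]scale1r -sq; congr (_ *: _); ring.
- by rewrite -!scalar_mxM; congr (_%:M); rewrite -[RHS]mul1r -sq; ring.
Qed.

(** The jet cocycle K is block upper triangular, so the upper-left block of K^T X K involves only
    that of X. *)
Lemma ulsubmx_cocycle (X : 'M[R]_(n + 1)) :
  ulsubmx X = lam2 *: (J y *m ulsubmx ((jet_cocycle a b y)^T *m X *m jet_cocycle a b y) *m (J y)^T).
Proof.
have uJ := trans_jac_unit Vy.
have -> : ulsubmx ((jet_cocycle a b y)^T *m X *m jet_cocycle a b y) =
    (lam * lam) *: (invmx (J y) *m ulsubmx X *m (invmx (J y))^T).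
  rewrite -{1}[X]submxK /jet_cocycle tr_block_mx !mulmx_block block_mxKul.
  rewrite !trmx0 !mul0mx !mulmx0 !addr0 trmx_scaleE trmxK.
  by rewrite -!scalemxAl -!scalemxAr scalerA.
rewrite -!scalemxAr -!scalemxAl scalerA mulrC density_factor_sq scale1r.
by rewrite !mulmxA mulmxV// mul1mx -mulmxA -trmx_mul mulmxV// trmx1 mulmx1.
Qed.

End TractorTransition.

Section NablaLocal.
Context {R : realType} {n : nat} {M : manifold R n}.
Variables (g : field M n n) (a : chart_ix M) (w : R).
Local Notation U := (chart_im a).
Let oU := @open_chart_im _ _ _ a.

Lemma eq_on_nabla_TM (m m' : 'rV[R]_n -> 'cV[R]_n) y k b :
  U y -> {in U, m =1 m'} -> nabla_TM g a w m y k b = nabla_TM g a w m' y k b.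
Proof.
move=> Uy e; rewrite !nabla_TME /covTM (eq_on_pdmx k oU Uy e).
by rewrite e ?inE.
Qed.

Lemma eq_on_nabla_density (f f' : 'rV[R]_n -> R) y k :
  U y -> {in U, f =1 f'} -> nabla_density g a w f y k = nabla_density g a w f' y k.
Proof.
move=> Uy e; rewrite /nabla_density (eq_on_pd k oU Uy e).
by rewrite e ?inE.
Qed.

End NablaLocal.

(** * The bijection between parallel tractors and metrisability solutions *)

Section Correspondence.
Context {R : realType} {n : nat} (hn : (2 <= n)%N) {M : manifold R n}.
Variables (g : field M n n) (hg : is_metric g) (B : points M -> R) (B0 : R).
Hypothesis BB0 : forall x, B x = B0.

Lemma parallel_metrisability S :
  tractor_parallel g B S -> metrisability_solution g (split_sigma g S).
Proof.
move=> [[[smS S0 lawS] symS] par].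
have E a : split_sigma g S a = fun y => ulsubmx (S a y).
  by apply/funext => y; exact: split_sigmaE.
split; first split; first split.
- move=> a i j; rewrite E; under eq_fun do rewrite !mxE; exact: smS.
- by move=> a y Uy; rewrite E S0//; apply/matrixP => i j; rewrite !mxE.
- by move=> a b y Vy; rewrite !E (lawS _ _ _ Vy) -ulsubmx_cocycle.
- by move=> a y; rewrite E trmx_ulsub symS.
move=> a y Uy; have [eq1 _ _] := par a y Uy.
by apply/metrisability_covS; rewrite (div_mu_unique eq1).
Qed.

Lemma split_sigma_inj S S' : tractor_parallel g B S -> tractor_parallel g B S' ->
  split_sigma g S = split_sigma g S' -> S = S'.
Proof.
move=> [[[_ S0 _] symS] par] [[[_ S0' _] symS'] par'] es.
apply/funext => a.
have es_a : split_sigma g S a = split_sigma g S' a by rewrite es.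
(* Equality is needed as functions on the chart and not just at one point, since rho is recovered by
   differentiating mu. *)
have em : split_mu g S a = split_mu g S' a.
  apply/funext => y; have [Uy|nUy] := pselect (chart_im a y).
    have [eq1 _ _] := par a y Uy; have [eq1' _ _] := par' a y Uy.
    by rewrite -(div_mu_unique eq1) -(div_mu_unique eq1') es_a.
  by rewrite /split_mu /tractor_split S0// S0'.
apply/funext => y; have [Uy|nUy] := pselect (chart_im a y); last by rewrite S0// S0'.
rewrite (unsplitE g (symS a y)) (unsplitE g (symS' a y)) es_a em; congr unsplit_mx.
have [_ eq2 _] := par a y Uy; have [_ eq2' _] := par' a y Uy.
by rewrite -(div_rho_unique (ltnW hn) eq2) -(div_rho_unique (ltnW hn) eq2') es_a em.
Qed.

Hypothesis nullity : forall a y, chart_im a y ->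
  exists2 v : 'cV[R]_n, v != 0 & in_nullity g a y v.
Hypothesis BE : forall a y, chart_im a y -> forall v : 'cV[R]_n, in_nullity g a y v ->
  forall i, \sum_j schouten_up g a y i j * v j 0 = B0 * v i 0.

(** Off the chart image the value is the 0 prescribed by [is_section], where the formula for the
    slots has no meaning. *)
Definition prolong (s : field M n n) : field M (n + 1) (n + 1) := fun a y =>
  if `[< chart_im a y >] then
    let mu := div_mu g a (-2) (s a) in
    unsplit_mx g a y (s a y) (mu y) (div_rho g a (-2) B0 (s a) mu y)
  else 0.

Lemma prolong_in s a y : chart_im a y -> prolong s a y =
  unsplit_mx g a y (s a y) (div_mu g a (-2) (s a) y)
    (div_rho g a (-2) B0 (s a) (div_mu g a (-2) (s a)) y).
Proof. by move=> Uy; rewrite /prolong; case: asboolP. Qed.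

Lemma prolong_out s a y : ~ chart_im a y -> prolong s a y = 0.
Proof. by move=> Uy; rewrite /prolong; case: asboolP. Qed.

Lemma split_sigma_prolong s : is_S2TM_section (-2) s -> split_sigma g (prolong s) = s.
Proof.
move=> [[_ s0 _] _]; apply/funext => a; apply/funext => y.
have [Uy|nUy] := pselect (chart_im a y).
  by have [] := split_unsplit (prolong_in s Uy).
by rewrite split_sigmaE prolong_out// s0//; apply/matrixP => i j; rewrite !mxE.
Qed.

Lemma prolong_section s : is_S2TM_section (-2) s -> is_S2T_section (prolong s).
Proof.
move=> [[sms s0 laws] syms]; split; last first.
  move=> a y; have [Uy|nUy] := pselect (chart_im a y).
    by rewrite !prolong_in// trmx_unsplit.
  by rewrite !prolong_out// trmx0.
split; last first.
- move=> a b y Vy.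
  have Uy := overlap_chart_im Vy.
  have Uty := overlap_chart_im (transition_overlap Vy).
  have da z (Vz : overlap a b z) := smooth_mx_differentiable (sms a) (overlap_chart_im Vz).
  have db z (Vz : overlap a b z) :=
    smooth_mx_differentiable (sms b) (overlap_chart_im (transition_overlap Vz)).
  have law := laws a b.
  (* The law for mu is established on the whole overlap because the law for rho differentiates
     it. *)
  have emu z (Vz : overlap a b z) := div_mu_transition hg Vz (da z Vz) (db z Vz) law.
  have dma := smooth_mx_differentiable (div_mu_smooth (-2) hg (sms a)) Uy.
  have dmb := smooth_mx_differentiable (div_mu_smooth (-2) hg (sms b)) Uty.
  have erho := div_rho_transition hg Vy B0 dma dmb (law y Vy) emu (syms a y).
  by rewrite !prolong_in// (law y Vy) (emu y Vy) erho unsplit_transition.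
- by move=> a y nUy; rewrite prolong_out.
move=> a; have oU := @open_chart_im _ _ _ a.
have smu := div_mu_smooth (-2) hg (sms a).
apply: (eq_on_smooth_mx oU (F := fun y => unsplit_mx g a y (s a y) (div_mu g a (-2) (s a) y)
    (div_rho g a (-2) B0 (s a) (div_mu g a (-2) (s a)) y))).
  by move=> y; rewrite inE => Uy; rewrite prolong_in.
have sQ := jet_splitting_smooth (a := a) hg.
apply: smooth_mxM => //; apply: smooth_mxM => //; first exact: smooth_mx_tr.
apply: smooth_mx_block => //; first exact: smooth_mx_tr.
move=> i j; rewrite (ord1 i) (ord1 j); under eq_fun do rewrite mxE eqxx mulr1n.
exact: div_rho_smooth.
Qed.

Lemma prolong_parallel s :
  metrisability_solution g s -> tractor_parallel g B (prolong s).
Proof.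
move=> [secs trs]; split; first exact: prolong_section.
move=> a y Uy /=; rewrite BB0 split_sigma_prolong//.
have [[sms _ _] syms] := secs.
have emu : {in chart_im a, split_mu g (prolong s) a =1 div_mu g a (-2) (s a)}.
  by move=> z; rewrite inE => Uz; have [] := split_unsplit (prolong_in s Uz).
have erho : {in chart_im a, split_rho g (prolong s) a =1
    div_rho g a (-2) B0 (s a) (div_mu g a (-2) (s a))}.
  by move=> z; rewrite inE => Uz; have [] := split_unsplit (prolong_in s Uz).
have Uy' : y \in chart_im a by rewrite inE.
have tr_a := trs a.
have sy z (_ : chart_im a z) := syms a z.
split.
- by rewrite emu//; apply/metrisability_covS; exact: trs.
- move=> k b; rewrite (eq_on_nabla_TM _ _ _ _ Uy emu) erho//.
  exact: (nabla_mu hg hn (@nullity a) (@BE a) (sms a) sy tr_a Uy).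
- move=> k; rewrite (eq_on_nabla_density _ _ _ Uy erho) emu//.
  exact: (nabla_rho hg hn (@nullity a) (@BE a) (sms a) sy tr_a Uy).
Qed.

End Correspondence.

Theorem theorem4p12 (R : realType) (n : nat) (hn : (2 <= n)%N)
    (M : manifold R n) (m : set (field M n n))
    (hm : metric_projective_structure m) (hW : has_weyl_nullity m)
    (g : field M n n) (hg : m g)
    (B : points M -> R) (hB : is_nullity_function g B)
    (hBconst : exists B0 : R, forall x, B x = B0) :
  set_bij [set S : field M (n + 1) (n + 1) | tractor_parallel g B S]
          [set s : field M n n | metrisability_solution g s]
          (split_sigma g).
Proof.
have [B0 BB0] := hBconst.
have mg : is_metric g by case: hm hg => g0 _ -> [].
have nullity a y : chart_im a y -> exists2 v : 'cV[R]_n, v != 0 & in_nullity g a y v.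
  by move=> [x ax <-]; exact: hW.
have BE a y : chart_im a y -> forall v : 'cV[R]_n, in_nullity g a y v ->
    forall i, \sum_j schouten_up g a y i j * v j 0 = B0 * v i 0.
  by move=> [x ax <-] v Wv i; rewrite (hB a x ax v Wv) BB0.
split.
- by move=> S /= /parallel_metrisability.
- by move=> S S'; rewrite !inE; exact: split_sigma_inj.
- move=> s /= hs; exists (prolong g B0 s).
    exact: prolong_parallel.
  by apply: split_sigma_prolong; case: hs.
Qed.
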